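(* Let $(\Sigma,\mathcal{T})$ be an ideally triangulated compact 3-dimensional manifold with boundary, with hyper-ideal vertex set $V=\{1,\dots,N\}$ and edge set $E$, and let $\Phi: E\to[0,\arccos\frac13]$ be a weight. Then generalized Thurston's sphere packing metrics on $(\Sigma,\mathcal{T},\Phi)$ cannot be deformed while keeping the combinatorial Ricci curvatures along the edges fixed: for every generalized Thurston's sphere packing metric $\overline{r}\in\Omega(\Phi)$ there is a neighborhood $U\subseteq\Omega(\Phi)$ of $\overline{r}$ such that if $r\in U$ satisfies $K_{ij}(r)=K_{ij}(\overline{r})$ for every edge $\{ij\}\in E$, then $r=\overline{r}$.
   Context: $\Sigma$ is obtained from a compact 3-manifold $\widetilde\Sigma$ whose boundary has $N$ components by coning each boundary component to a point; an ideal triangulation $\mathcal{T}$ is a triangulation of $\Sigma$ whose vertices are exactly these cone points. Each tetrahedron of $\mathcal T$ is realized as a hyper-ideal tetrahedron: a compact convex polyhedron in $\mathbb{H}^3$ diffeomorphic to a truncated Euclidean tetrahedron, with four right-angled hyperbolic hexagonal faces and four hyperbolic triangular faces (''vertex triangles'' $\triangle_i$, one for each vertex $i$), each vertex triangle orthogonal to its three adjacent hexagons; the edge $\{ij\}$ is the intersection of two hexagonal faces and joins $\triangle_i$ to $\triangle_j$; $l_{ij}$ denotes its length. Gluing is by isometries of hexagonal faces. A generalized Thurston's sphere packing metric on $(\Sigma,\mathcal T,\Phi)$ is a map $r:V\to(0,\infty)$ such that, setting $l_{ij}=\cosh^{-1}(\sinh r_i\sinh r_j+\cos\Phi_{ij}\cosh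 r_i\cosh r_j)$ for each edge, for every tetrahedron $\{ijkh\}\in T$ the six numbers $l_{ij},l_{ik},l_{ih},l_{jk},l_{jh},l_{kh}$ are the edge lengths of a (non-degenerate) hyper-ideal tetrahedron. The set of all such $r$ is the admissible space $\Omega(\Phi)\subseteq\mathbb{R}^N_{>0}$. The combinatorial Ricci curvature along an edge is $K_{ij}=2\pi-\sum_{\{ijkh\}\in T}\beta_{ij,kh}$, where $\beta_{ij,kh}$ is the dihedral angle at edge $\{ij\}$ of the hyper-ideal tetrahedron $\{ijkh\}$, summed over all tetrahedra containing $\{ij\}$. *)

(* Defs.v *)
From Stdlib Require Import Reals ClassicalEpsilon.
From mathcomp Require Import all_boot.

Set Implicit Arguments.
Unset Strict Implicit.
Unset Printing Implicit Defensive.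

(* Tetrahedra are 'I_ntet, corners of a tetrahedron are 'I_4.          *)
(* The face of tetrahedron t opposite corner f is glued to the face of *)
(* tetrahedron (gtet t f) opposite corner (gmap t f f), the corner c   *)
(* of t going to the corner (gmap t f c).                              *)

Definition corner_rel (n : nat) (gtet : 'I_n -> 'I_4 -> 'I_n)
  (gmap : 'I_n -> 'I_4 -> 'I_4 -> 'I_4) : rel ('I_n * 'I_4) :=
  fun x y => [exists f : 'I_4, (f != x.2) && (y == (gtet x.1 f, gmap x.1 f x.2))].

Definition slot_rel (n : nat) (gtet : 'I_n -> 'I_4 -> 'I_n)
  (gmap : 'I_n -> 'I_4 -> 'I_4 -> 'I_4) : rel ('I_n * 'I_4 * 'I_4) :=
  fun x y => let: (t, a, b) := x in
    [exists f : 'I_4, [&& f != a, f != b &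
       y == (gtet t f, gmap t f a, gmap t f b)]].

(* An ideal triangulation of the space Sigma obtained from a compact
   3-manifold with N boundary components by coning each boundary
   component to a point; its vertices are the N cone points 'I_N,
   its edges are 'I_nedge. *)
Record ideal_triangulation (N : nat) := IdealTriangulation {
  ntet : nat;
  nedge : nat;
  tvert : 'I_ntet -> 'I_4 -> 'I_N;
  tedge : 'I_ntet -> 'I_4 -> 'I_4 -> 'I_nedge;
  gtet : 'I_ntet -> 'I_4 -> 'I_ntet;
  gmap : 'I_ntet -> 'I_4 -> 'I_4 -> 'I_4;
  tedge_sym : forall t a b, tedge t a b = tedge t b a;
  gmap_inj : forall t f, injective (gmap t f);
  glue_invol : forall t f, gtet (gtet t f) (gmap t f f) = t /\
      forall c, gmap (gtet t f) (gmap t f f) (gmap t f c) = c;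
  glue_nofix : forall t f, (gtet t f, gmap t f f) <> (t, f);
  glue_vert : forall t f c, c != f -> tvert (gtet t f) (gmap t f c) = tvert t c;
  glue_edge : forall t f a b, a != f -> b != f ->
      tedge (gtet t f) (gmap t f a) (gmap t f b) = tedge t a b;
  tvert_surj : forall i, exists t c, tvert t c = i;
  tedge_surj : forall e, exists t a b, a != b /\ tedge t a b = e;
  vert_classes : forall t c t' c', tvert t c = tvert t' c' ->
      connect (corner_rel gtet gmap) (t, c) (t', c');
  edge_classes : forall t a b t' a' b', a != b -> a' != b' ->
      tedge t a b = tedge t' a' b' ->
      connect (slot_rel gtet gmap) (t, a, b) (t', a', b')
      || connect (slot_rel gtet gmap) (t, a, b) (t', b', a');
  (* manifold condition: no edge is glued to itself with reversed orientation
     (so that the complement of the cone points is a 3-manifold) *)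
  edge_no_reverse : forall t a b, a != b ->
      ~~ connect (slot_rel gtet gmap) (t, a, b) (t, b, a)
}.

Local Open Scope R_scope.

Definition vec4 := 'I_4 -> R.

Definition sumI (n : nat) (f : 'I_n -> R) : R :=
  foldr Rplus 0 (map f (enum 'I_n)).

Definition mink (x y : vec4) : R :=
  - (x ord0 * y ord0) + sumI (fun k => if k == ord0 then 0 else x k * y k).

Definition acosh (x : R) : R := ln (x + sqrt (x * x - 1)).

(* v : the four (normalized) hyper-ideal vertices of a hyper-ideal
   tetrahedron, as spacelike unit vectors of R^{3,1} (poles of the four
   truncating planes); the tetrahedron is the projectivized cone of
   nonnegative combinations of the v c, truncated by the polar planes.
   Non-degeneracy = linear independence; every edge meets H^3 iff
   <v a, v b> < -1.  Its edge lengths are acosh(-<v a, v b>). *)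
Definition hyperideal_tet (v : 'I_4 -> vec4) : Prop :=
  (forall c, mink (v c) (v c) = 1) /\
  (forall lam : 'I_4 -> R,
     (forall k, sumI (fun c => lam c * v c k) = 0) -> forall c, lam c = 0) /\
  (forall a b : 'I_4, a != b -> mink (v a) (v b) < -1).

(* n : outward unit normals of the four hexagonal faces, n h for the face
   opposite to corner h (half-space <x, n h> <= 0 contains the tetrahedron) *)
Definition outward_normals (v : 'I_4 -> vec4) (n : 'I_4 -> vec4) : Prop :=
  forall h, mink (n h) (n h) = 1 /\ mink (n h) (v h) < 0 /\
            (forall c, c != h -> mink (n h) (v c) = 0).

Definition has_lengths (v : 'I_4 -> vec4) (L : 'I_4 -> 'I_4 -> R) : Prop :=
  forall a b : 'I_4, a != b -> acosh (- mink (v a) (v b)) = L a b.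

Definition is_dihedral (L : 'I_4 -> 'I_4 -> R) (a b : 'I_4) (beta : R) : Prop :=
  exists v n, hyperideal_tet v /\ has_lengths v L /\ outward_normals v n /\
    forall c d : 'I_4, [&& c != a, c != b, d != a, d != b & c != d] ->
      beta = acos (- mink (n c) (n d)).

(* the dihedral angle (well defined when L are the lengths of a hyper-ideal
   tetrahedron, since these determine it up to isometry) *)
Definition dihedral (L : 'I_4 -> 'I_4 -> R) (a b : 'I_4) : R :=
  epsilon (inhabits 0) (is_dihedral L a b).

Section Packing.
Variables (N : nat) (T : ideal_triangulation N).

Definition cosh_len (Phi : 'I_(nedge T) -> R) (r : 'I_N -> R)
    (t : 'I_(ntet T)) (a b : 'I_4) : R :=
  let i := tvert t a in let j := tvert t b in
  sinh (r i) * sinh (r j) + cos (Phi (tedge t a b)) * cosh (r i) * cosh (r j).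

Definition tet_len (Phi : 'I_(nedge T) -> R) (r : 'I_N -> R)
    (t : 'I_(ntet T)) : 'I_4 -> 'I_4 -> R :=
  fun a b => acosh (cosh_len Phi r t a b).

Definition admissible (Phi : 'I_(nedge T) -> R) (r : 'I_N -> R) : Prop :=
  (forall i, 0 < r i) /\
  forall t : 'I_(ntet T),
    (forall a b : 'I_4, a != b -> 1 <= cosh_len Phi r t a b) /\
    exists v, hyperideal_tet v /\ has_lengths v (tet_len Phi r t).

Definition slots : seq ('I_(ntet T) * 'I_4 * 'I_4) :=
  filter (fun x : 'I_(ntet T) * 'I_4 * 'I_4 => (nat_of_ord x.1.2 < nat_of_ord x.2)%N)
    (enum {: 'I_(ntet T) * 'I_4 * 'I_4}).

Definition ricci (Phi : 'I_(nedge T) -> R) (r : 'I_N -> R)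
    (e : 'I_(nedge T)) : R :=
  2 * PI - foldr Rplus 0
    [seq dihedral (tet_len Phi r x.1.1) x.1.2 x.2
    | x <- slots & tedge x.1.1 x.1.2 x.2 == e].

End Packing.

(* Main.v *)
Require Import Defs.
From Stdlib Require Import Reals Lra Psatz ClassicalEpsilon.
From mathcomp Require Import all_boot all_order all_algebra.
From mathcomp Require Import all_reals Rstruct Rstruct_topology zify.
From mathcomp Require all_classical all_analysis ring lra.
Local Open Scope R_scope.

(* Fix a hyper-ideal tetrahedron with edge lengths l and dihedral angles beta,
   and let G be its vertex Gram matrix (1 on the diagonal, -cosh l off it).
   The cosines of the angles are the normalized cofactors of G, and the
   Jacobian of l |-> beta is, up to a diagonal congruence and a positive factor,
   an explicit symmetric 6x6 matrix J(G).  It is invertible as soon as G has the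
   signature of a hyper-ideal tetrahedron: a variation of G killing all d beta
   rescales rows and columns of the adjugate, hence of G, and the diagonal of G
   is fixed.  Since J is positive definite at a regular tetrahedron, it is
   positive definite at every G joined to a regular one by a path of hyper-ideal
   Gram matrices.  For a sphere packing such a path is obtained by moving all
   weights cos Phi to 1 and enlarging all radii to a common value: the edges stay
   ultraparallel by monotonicity, and det G stays negative because
   cos Phi >= 1/3.
   Hence beta is locally strictly monotone, sum (beta' - beta)(l' - l) > 0 unless
   l' = l.  Summing over all tetrahedra, fixed edge curvatures make the total
   vanish, so all lengths agree; and the lengths of a triangle determine its
   radii because each length increases with both radii. *)

(** Rigidity is local because the angles at two packings are compared by the mean value theorem
    along the straight segment between their edge lengths, and such a segment is only known to stay
    among hyper-ideal tetrahedra when its ends are close. The path to the regular tetrahedron is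
    another matter: it may go far and change the weights, since [J(G)] depends on G alone. Transport
    along paths replaces any computation of minors of [J(G)]; what remains is a trivial kernel
    everywhere and one explicit diagonalization.

    The constant 1/3 comes from the limit of vanishing radii. There G tends to the matrix K with 1
    on the diagonal and -cos Phi off it. If all cosines are 1/3, each row of K sums to zero and det
    K = 0; larger cosines only decrease det K. Positive radii subtract from K a rank one matrix z
    z^T with z in (0, 1]^4, and this keeps the determinant strictly negative. *)

(** * The Gram matrix of a hyper-ideal tetrahedron *)

(* Throughout, (p, q, r, s, t, w) = (x_ab, x_ac, x_ad, x_bc, x_bd, x_cd) are the
   values cosh l for corners a, b, c, d, and the Gram matrix G has entries 1 on
   the diagonal and -x off it.  [gcof] is the cofactor at (a, b); permuting
   the corners permutes the arguments, so that [gcof w q s r t p] is the cofactor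
   at (c, d).  [dgminor], [dgcof], [dgdet] are differentials, capital letters
   being the variations of the lower case ones. *)
Definition gminor (p q s : R) : R := 1 - p * p - q * q - s * s - 2 * p * q * s.
Definition gcof (p q r s t w : R) : R :=
  p * (1 - w * w) + q * s + r * t + w * (q * t + r * s).
Definition gdet (p q r s t w : R) : R :=
  1 - p * p - q * q - r * r - s * s - t * t - w * w
  + p * p * w * w + q * q * t * t + r * r * s * s
  - 2 * (p * q * s + p * r * t + q * r * w + s * t * w)
  - 2 * (p * w * q * t + p * w * r * s + q * t * r * s).

Definition dgminor p q s P Q S : R :=
  - 2 * (p * P + q * Q + s * S + P * q * s + p * Q * s + p * q * S).
Definition dgcof p q r s t w P Q R' S T W : R :=
  P * (1 - w * w) - 2 * p * w * W + Q * s + q * S + R' * t + r * T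
  + W * (q * t + r * s) + w * (Q * t + q * T + R' * s + r * S).
Definition dgdet p q r s t w P Q R' S T W : R :=
  - 2 * (P * gcof p q r s t w + Q * gcof q p r s w t + R' * gcof r p q t w s
     + S * gcof s p t q w r + T * gcof t p s r w q + W * gcof w q s r t p).

(** Diagonal entry of [J(G)]. By [gjacobi] its denominator is the 2 by 2 minor of the adjugate on
    the corners c, d. *)
Definition kap (p q r s t w : R) : R :=
  (gcof q p r s w t * gcof t p s r w q + gcof s p t q w r * gcof r p q t w s
   - gcof w q s r t p *
     (gcof q p r s w t * gcof s p t q w r / gminor p r t
      + gcof r p q t w s * gcof t p s r w q / gminor p q s))
  / (gdet p q r s t w * (1 - p * p)).

(* A positive multiple of d beta_ab, see [angle_deriv].  The coefficients of the
   two edges ab and ac in each other's rows coincide: both are the cofactor at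
   (a, d) over the minor omitting d. *)
Definition angrow (p q r s t w P Q R' S T W : R) : R :=
  W + Q * (gcof r p q t w s / gminor p q s)
    + R' * (gcof q p r s w t / gminor p r t)
    + S * (gcof t p s r w q / gminor p q s)
    + T * (gcof s p t q w r / gminor p r t)
    + P * kap p q r s t w.

(** Jacobi's identity on complementary minors: a 2 by 2 minor of the adjugate is det G times the
    complementary minor of G. Its positivity is what keeps the cosine of the dihedral angle inside
    (-1, 1). *)
Lemma gjacobi p q r s t w :
  gminor p r t * gminor p q s - gcof w q s r t p * gcof w q s r t p
  = gdet p q r s t w * (1 - p * p).
Proof. unfold gminor, gcof, gdet; ring. Qed.

Lemma gdet_views p q r s t w : gdet q p r s w t = gdet p q r s t w /\
  gdet r p q t w s = gdet p q r s t w /\ gdet s p t q w r = gdet p q r s t w /\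
  gdet t p s r w q = gdet p q r s t w /\ gdet w q s r t p = gdet p q r s t w.
Proof. by rewrite /gdet; repeat split; ring. Qed.

(** Divided by [sqrt (Mc Md)], the left side is the differential of
    [cos beta_ab = C_cd / sqrt (Mc Md)]. Taking out 1 - p^2 normalizes the coefficient of the
    opposite edge to 1, and this makes the six rows symmetric. *)
Lemma angrow_eq p q r s t w P Q R' S T W :
  gminor p r t <> 0 -> gminor p q s <> 0 -> gdet p q r s t w <> 0 -> 1 - p * p <> 0 ->
  dgcof w q s r t p W Q S R' T P
  - / 2 * gcof w q s r t p *
    (dgminor p r t P R' T / gminor p r t + dgminor p q s P Q S / gminor p q s)
  = (1 - p * p) * angrow p q r s t w P Q R' S T W.
Proof.
intros Hc Hd HD Hp.
unfold angrow, kap.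
set (Mc := gminor p r t) in *; set (Md := gminor p q s) in *.
set (D := gdet p q r s t w) in *.
apply (Rmult_eq_reg_l (D * Mc * Md));
  [|repeat apply Rmult_integral_contrapositive_currified; assumption].
transitivity (D * Mc * Md * dgcof w q s r t p W Q S R' T P
  - / 2 * gcof w q s r t p * D * (dgminor p r t P R' T * Md + dgminor p q s P Q S * Mc)).
{ field; split; assumption. }
symmetry.
transitivity ((1 - p * p) * D * (W * Mc * Md + Q * gcof r p q t w s * Mc
      + R' * gcof q p r s w t * Md + S * gcof t p s r w q * Mc + T * gcof s p t q w r * Md)
   + P * ((gcof q p r s w t * gcof t p s r w q + gcof s p t q w r * gcof r p q t w s) * Mc * Md
   - gcof w q s r t p *
     (gcof q p r s w t * gcof s p t q w r * Md
      + gcof r p q t w s * gcof t p s r w q * Mc))).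
{ field; repeat split; assumption. }
unfold Mc, Md, D, gminor, gcof, dgminor, dgcof, gdet.
field.
Qed.

(* If dA = (uA + Au) / 2 for the adjugate A and a diagonal u, then, from
   A G = (det G) I, (det G) dG = (d det G) G - (det G) (uG + Gu) / 2; these are
   the entries (a, a) and (a, b). *)
Lemma adjugate_variation p q r s t w P Q R' S T W ua ub uc ud :
  dgminor p r t P R' T = uc * gminor p r t ->
  dgminor p q s P Q S = ud * gminor p q s ->
  dgminor s t w S T W = ua * gminor s t w ->
  dgminor q r w Q R' W = ub * gminor q r w ->
  2 * dgcof p q r s t w P Q R' S T W = gcof p q r s t w * (ua + ub) ->
  2 * dgcof q p r s w t Q P R' S W T = gcof q p r s w t * (ua + uc) ->
  2 * dgcof r p q t w s R' P Q T W S = gcof r p q t w s * (ua + ud) ->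
  2 * dgcof s p t q w r S P T Q W R' = gcof s p t q w r * (ub + uc) ->
  2 * dgcof t p s r w q T P S R' W Q = gcof t p s r w q * (ub + ud) ->
  2 * dgcof w q s r t p W Q S R' T P = gcof w q s r t p * (uc + ud) ->
  gdet p q r s t w * ua = dgdet p q r s t w P Q R' S T W /\
  gdet p q r s t w * P = p * (dgdet p q r s t w P Q R' S T W - / 2 * gdet p q r s t w * (ua + ub)).
Proof.
intros Hc Hd Ha Hb Hab Hac Had Hbc Hbd Hcd.
split.
- transitivity (ua * gminor s t w + p * p * (ub * gminor q r w) + q * q * (uc * gminor p r t)
    + r * r * (ud * gminor p q s)
    - p * (gcof p q r s t w * (ua + ub)) - q * (gcof q p r s w t * (ua + uc))
    - r * (gcof r p q t w s * (ua + ud)) + p * q * (gcof s p t q w r * (ub + uc))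
    + p * r * (gcof t p s r w q * (ub + ud)) + q * r * (gcof w q s r t p * (uc + ud))).
  { unfold gdet, gminor, gcof. ring. }
  rewrite <- Ha, <- Hb, <- Hc, <- Hd, <- Hab, <- Hac, <- Had, <- Hbc, <- Hbd, <- Hcd.
  unfold dgdet, dgminor, dgcof, gcof. ring.
- apply (Rmult_eq_reg_l 2); [|lra].
  transitivity (2 * p * dgdet p q r s t w P Q R' S T W + (
     - 2 * p * dgminor s t w S T W - 2 * p * dgminor q r w Q R' W
    + 2 * q * s * dgminor p r t P R' T + 2 * r * t * dgminor p q s P Q S
    + (1 + p * p) * (2 * dgcof p q r s t w P Q R' S T W)
    + (p * q - s) * (2 * dgcof q p r s w t Q P R' S W T)
    + (p * r - t) * (2 * dgcof r p q t w s R' P Q T W S)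
    + (p * s - q) * (2 * dgcof s p t q w r S P T Q W R')
    + (p * t - r) * (2 * dgcof t p s r w q T P S R' W Q)
    + (q * t + r * s) * (2 * dgcof w q s r t p W Q S R' T P))).
  { unfold dgdet, gdet, dgminor, dgcof, gcof. ring. }
  rewrite Ha Hb Hc Hd Hab Hac Had Hbc Hbd Hcd.
  unfold gdet, gminor, gcof. field.
Qed.

Lemma gminor_neg p q s : 1 < p -> 1 < q -> 1 < s -> gminor p q s < 0.
Proof.
intros hp hq hs; unfold gminor.
assert (0 < p * q) by nra. assert (0 < p * q * s) by (apply Rmult_lt_0_compat; lra).
nra.
Qed.

Ltac gram_perm := unfold gminor, dgminor, gdet, dgdet, gcof, dgcof in *; lra.

Lemma angrow_nondeg x12 x13 x14 x23 x24 x34 y12 y13 y14 y23 y24 y34 :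
  1 < x12 -> 1 < x13 -> 1 < x14 -> 1 < x23 -> 1 < x24 -> 1 < x34 ->
  gdet x12 x13 x14 x23 x24 x34 < 0 ->
  angrow x12 x13 x14 x23 x24 x34 y12 y13 y14 y23 y24 y34 = 0 ->
  angrow x13 x12 x14 x23 x34 x24 y13 y12 y14 y23 y34 y24 = 0 ->
  angrow x14 x12 x13 x24 x34 x23 y14 y12 y13 y24 y34 y23 = 0 ->
  angrow x23 x12 x24 x13 x34 x14 y23 y12 y24 y13 y34 y14 = 0 ->
  angrow x24 x12 x23 x14 x34 x13 y24 y12 y23 y14 y34 y13 = 0 ->
  angrow x34 x13 x23 x14 x24 x12 y34 y13 y23 y14 y24 y12 = 0 ->
  y12 = 0 /\ y13 = 0 /\ y14 = 0 /\ y23 = 0 /\ y24 = 0 /\ y34 = 0.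
Proof.
intros h12 h13 h14 h23 h24 h34 hD e12 e13 e14 e23 e24 e34.
(* A vanishing row says that the cofactor at (c, d) varies like [sqrt (Mc Md)]. With u the
   logarithmic derivatives of the principal minors, this is the hypothesis of
   [adjugate_variation]. *)
assert (H : forall p q r s t w P Q R' S T W uc ud,
  1 < p -> gminor p r t < 0 -> gminor p q s < 0 ->
  gdet p q r s t w < 0 ->
  dgminor p r t P R' T = uc * gminor p r t ->
  dgminor p q s P Q S = ud * gminor p q s ->
  angrow p q r s t w P Q R' S T W = 0 ->
  2 * dgcof w q s r t p W Q S R' T P = gcof w q s r t p * (uc + ud)).
{ intros p q r s t w P Q R' S T W uc ud hp h1 h2 HD Hc Hd e.
  assert (E := angrow_eq p q r s t w P Q R' S T W). rewrite e Hc Hd in E.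
  assert (hp2 : 1 - p * p <> 0) by (apply Rlt_not_eq; nra).
  specialize (E (Rlt_not_eq _ _ h1) (Rlt_not_eq _ _ h2) (Rlt_not_eq _ _ HD) hp2).
  replace (uc + ud) with (uc * gminor p r t / gminor p r t + ud * gminor p q s / gminor p q s)
    by (field; split; apply Rlt_not_eq; assumption).
  lra. }
assert (m1 := gminor_neg _ _ _ h23 h24 h34); assert (m2 := gminor_neg _ _ _ h13 h14 h34).
assert (m3 := gminor_neg _ _ _ h12 h14 h24); assert (m4 := gminor_neg _ _ _ h12 h13 h23).
assert (D : forall m d, m < 0 -> exists u, d = u * m)
  by (intros m d hm; exists (d / m); field; apply Rlt_not_eq; exact hm).
destruct (D _ (dgminor x23 x24 x34 y23 y24 y34) m1) as [u1 d1].
destruct (D _ (dgminor x13 x14 x34 y13 y14 y34) m2) as [u2 d2].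
destruct (D _ (dgminor x12 x14 x24 y12 y14 y24) m3) as [u3 d3].
destruct (D _ (dgminor x12 x13 x23 y12 y13 y23) m4) as [u4 d4].
clear D.
apply (H _ _ _ _ _ _ _ _ _ _ _ _ u3 u4) in e12; try assumption.
apply (H _ _ _ _ _ _ _ _ _ _ _ _ u2 u4) in e13; [|assumption|clear H; gram_perm..].
apply (H _ _ _ _ _ _ _ _ _ _ _ _ u2 u3) in e14; [|assumption|clear H; gram_perm..].
apply (H _ _ _ _ _ _ _ _ _ _ _ _ u1 u4) in e23; [|assumption|clear H; gram_perm..].
apply (H _ _ _ _ _ _ _ _ _ _ _ _ u1 u3) in e24; [|assumption|clear H; gram_perm..].
apply (H _ _ _ _ _ _ _ _ _ _ _ _ u1 u2) in e34; [|assumption|clear H; gram_perm..].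
clear H.
(* Four views put each corner first once and give [D * u = dD] for all four u; the two further views
   supply the equations of the remaining edges. *)
destruct (adjugate_variation x12 x13 x14 x23 x24 x34 y12 y13 y14 y23 y24 y34 u1 u2 u3 u4)
 as [v1 z12]; [gram_perm..|].
destruct (adjugate_variation x23 x12 x24 x13 x34 x14 y23 y12 y24 y13 y34 y14 u2 u3 u1 u4)
 as [v2 z23]; [gram_perm..|].
destruct (adjugate_variation x34 x13 x23 x14 x24 x12 y34 y13 y23 y14 y24 y12 u3 u4 u1 u2)
 as [v3 z34]; [gram_perm..|].
destruct (adjugate_variation x14 x24 x34 x12 x13 x23 y14 y24 y34 y12 y13 y23 u4 u1 u2 u3)
 as [v4 z14]; [gram_perm..|].
destruct (adjugate_variation x13 x12 x14 x23 x34 x24 y13 y12 y14 y23 y34 y24 u1 u3 u2 u4)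
 as [_ z13]; [gram_perm..|].
destruct (adjugate_variation x24 x12 x23 x14 x34 x13 y24 y12 y23 y14 y34 y13 u2 u4 u1 u3)
 as [_ z24]; [gram_perm..|].
set (D := gdet x12 x13 x14 x23 x24 x34) in *.
set (dD := dgdet x12 x13 x14 x23 x24 x34 y12 y13 y14 y23 y24 y34) in *.
replace (gdet x23 x12 x24 x13 x34 x14) with D in * by (unfold D, gdet; ring).
replace (gdet x34 x13 x23 x14 x24 x12) with D in * by (unfold D, gdet; ring).
replace (gdet x14 x24 x34 x12 x13 x23) with D in * by (unfold D, gdet; ring).
replace (gdet x13 x12 x14 x23 x34 x24) with D in * by (unfold D, gdet; ring).
replace (gdet x24 x12 x23 x14 x34 x13) with D in * by (unfold D, gdet; ring).
replace (dgdet x23 x12 x24 x13 x34 x14 y23 y12 y24 y13 y34 y14) with dD in *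
  by (unfold dD, dgdet, gcof; ring).
replace (dgdet x34 x13 x23 x14 x24 x12 y34 y13 y23 y14 y24 y12) with dD in *
  by (unfold dD, dgdet, gcof; ring).
replace (dgdet x14 x24 x34 x12 x13 x23 y14 y24 y34 y12 y13 y23) with dD in *
  by (unfold dD, dgdet, gcof; ring).
replace (dgdet x13 x12 x14 x23 x34 x24 y13 y12 y14 y23 y34 y24) with dD in *
  by (unfold dD, dgdet, gcof; ring).
replace (dgdet x24 x12 x23 x14 x34 x13 y24 y12 y23 y14 y34 y13) with dD in *
  by (unfold dD, dgdet, gcof; ring).
(* All four u are equal to dD / D, so the bracket multiplying x vanishes. *)
assert (Z : forall x y u u', D * u = dD -> D * u' = dD ->
  D * y = x * (dD - / 2 * D * (u + u')) -> y = 0).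
{ intros x y u u' hu hu' h. apply (Rmult_eq_reg_l D); [|lra].
  rewrite h. replace (/ 2 * D * (u + u')) with dD by lra. ring. }
repeat split; (eapply Z; [| |eassumption]; assumption).
Qed.

(** * Negativity of the determinant for weights with cosine at least 1/3 *)

(* The value at [t] of a quadratic with nonpositive linear term is controlled
   by the values at [0] and [1], whatever the sign of the leading term. *)
Lemma quad_neg al be ga t :
  be <= 0 -> al <= 0 -> al + be + ga < 0 -> 0 < t <= 1 -> al + be * t + ga * (t * t) < 0.
Proof.
intros hb ha h1 [t0 t1].
destruct (Rle_dec 0 ga) as [hg|hg].
- assert (0 <= ga * (t * (1 - t))) by (apply Rmult_le_pos; [|apply Rmult_le_pos]; lra).
  assert (0 <= - al * (1 - t)) by (apply Rmult_le_pos; lra).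
  assert (0 < - (al + be + ga) * t) by (apply Rmult_lt_0_compat; lra).
  nra.
- assert (0 < - ga * (t * t)) by (apply Rmult_lt_0_compat; nra). nra.
Qed.

Lemma quad_le al be ga t :
  be <= 0 -> al <= 0 -> al + be + ga <= 0 -> 0 <= t <= 1 -> al + be * t + ga * (t * t) <= 0.
Proof.
intros hb ha h1 [t0 t1].
destruct (Rle_dec 0 ga) as [hg|hg].
- assert (0 <= ga * (t * (1 - t))) by (apply Rmult_le_pos; [|apply Rmult_le_pos]; lra).
  assert (0 <= - al * (1 - t)) by (apply Rmult_le_pos; lra).
  assert (0 <= - (al + be + ga) * t) by (apply Rmult_le_pos; lra).
  nra.
- assert (0 <= - ga * (t * t)) by (apply Rmult_le_pos; nra). nra.
Qed.

Lemma quad_lt al be ga t :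
  be <= 0 -> al < 0 -> al + be + ga < 0 -> 0 <= t <= 1 -> al + be * t + ga * (t * t) < 0.
Proof.
intros hb ha h1 [[t0|<-] t1]; [|lra].
apply quad_neg; lra.
Qed.

(* det (K - z z^T) for K with entries 1 and -(p, ..., w), z = (a, b, c, d):
   expanding a rank one perturbation gives det K - z^T adj(K) z. *)
Definition pdet (p q r s t w a b c d : R) : R :=
  gdet p q r s t w - a * a * gminor s t w - b * b * gminor q r w
  - c * c * gminor p r t - d * d * gminor p q s
  - 2 * (a * b * gcof p q r s t w + a * c * gcof q p r s w t + a * d * gcof r p q t w s
     + b * c * gcof s p t q w r + b * d * gcof t p s r w q + c * d * gcof w q s r t p).

Definition third (x : R) := 1 / 3 <= x <= 1.

(** Makes the linear coefficients of [pdet], as a quadratic in each coordinate of z, nonpositive. *)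
Lemma gcof_ge0 p q r s t w : third p -> third q -> third r -> third s -> third t -> third w ->
  0 <= gcof p q r s t w.
Proof.
unfold third, gcof; intros hp hq hr hs ht hw.
assert (0 <= p * (1 - w * w)) by (apply Rmult_le_pos; nra).
assert (0 <= q * s) by nra. assert (0 <= r * t) by nra.
assert (0 <= w * (q * t + r * s)) by (apply Rmult_le_pos; nra). lra.
Qed.

Lemma gdet_mono p q r s t w : third p -> third q -> third r -> third s -> third t -> third w ->
  gdet p q r s t w <= gdet (1 / 3) q r s t w.
Proof.
unfold third; intros hp hq hr hs ht hw.
assert (0 <= (p - 1 / 3) * ((p + 1 / 3) * (1 - w * w) + 2 * (q * s + r * t + w * (q * t + r * s)))).
{ apply Rmult_le_pos; [lra|].
  assert (0 <= (p + 1 / 3) * (1 - w * w)) by (apply Rmult_le_pos; nra).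
  assert (0 <= q * s) by nra. assert (0 <= r * t) by nra.
  assert (0 <= w * (q * t + r * s)) by (apply Rmult_le_pos; nra). lra. }
unfold gdet; nra.
Qed.

(** The entries are lowered to 1/3 one at a time, which can only raise the determinant; at the end
    each row sums to 1 - 3/3 = 0 and the determinant is 0. *)
Lemma gdet_third_le0 p q r s t w :
  third p -> third q -> third r -> third s -> third t -> third w -> gdet p q r s t w <= 0.
Proof.
intros hp hq hr hs ht hw; assert (h3 : third (1 / 3)) by (unfold third; lra).
apply Rle_trans with (1 := gdet_mono p q r s t w hp hq hr hs ht hw).
assert (E2 := gdet_mono q (1/3) r s w t hq h3 hr hs hw ht).
assert (E3 := gdet_mono r (1/3) (1/3) t w s hr h3 h3 ht hw hs).
assert (E4 := gdet_mono s (1/3) t (1/3) w (1/3) hs h3 ht h3 hw h3).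
assert (E5 := gdet_mono t (1/3) (1/3) (1/3) w (1/3) ht h3 h3 h3 hw h3).
assert (E6 := gdet_mono w (1/3) (1/3) (1/3) (1/3) (1/3) hw h3 h3 h3 h3 h3).
unfold gdet in *; lra.
Qed.

Lemma pdet_corner1 p q r s t w :
  third p -> third q -> third r -> third s -> third t -> third w ->
  gdet p q r s t w - gminor s t w < 0.
Proof.
unfold third; intros hp hq hr hs ht hw.
replace (gdet p q r s t w - gminor s t w) with
 (- (p * p * (1 - w * w) + q * q * (1 - t * t) + r * r * (1 - s * s)
  + 2 * (p * q * (s + t * w)) + 2 * (p * r * (t + s * w)) + 2 * (q * r * (w + s * t))))
  by (unfold gdet, gminor; ring).
assert (0 <= p * p * (1 - w * w)) by (apply Rmult_le_pos; nra).
assert (0 <= q * q * (1 - t * t)) by (apply Rmult_le_pos; nra).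
assert (0 <= r * r * (1 - s * s)) by (apply Rmult_le_pos; nra).
assert (0 < p * q * (s + t * w)) by (apply Rmult_lt_0_compat; nra).
assert (0 < p * r * (t + s * w)) by (apply Rmult_lt_0_compat; nra).
assert (0 < q * r * (w + s * t)) by (apply Rmult_lt_0_compat; nra).
lra.
Qed.

(** K - z z^T now has zero diagonal. Its determinant is minus Heron's expression for a triangle with
    sides the square roots of a, b, c; these roots lie in [4/3, 2], so the strict triangle
    inequalities hold. *)
Lemma pdet_corner4 p q r s t w :
  third p -> third q -> third r -> third s -> third t -> third w ->
  pdet p q r s t w 1 1 1 1 < 0.
Proof.
unfold third; intros hp hq hr hs ht hw.
set (a := (1 + p) * (1 + w)); set (b := (1 + q) * (1 + t)); set (c := (1 + r) * (1 + s)).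
replace (pdet p q r s t w 1 1 1 1) with (a * a + b * b + c * c - 2 * (a * b + b * c + a * c))
  by (unfold pdet, gdet, gminor, gcof, a, b, c; ring).
assert (16 / 9 <= a <= 4) by (unfold a; nra).
assert (16 / 9 <= b <= 4) by (unfold b; nra).
assert (16 / 9 <= c <= 4) by (unfold c; nra).
clearbody a b c.
(* With a the largest, the expression is (b + c - a)^2 - 4 b c. *)
assert (Z : forall a b c, 16 / 9 <= a <= 4 -> 16 / 9 <= b <= 4 -> 16 / 9 <= c <= 4 ->
  b <= a -> c <= a -> a * a + b * b + c * c - 2 * (a * b + b * c + a * c) < 0).
{ clear. intros a b c ha hb hc hab hac.
  assert (hbc : 1 < b * c) by nra.
  assert ((b + c - a) * (b + c - a) < 4 * (b * c)).
  { destruct (Rle_dec 0 (b + c - a)).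
    - assert ((b + c - a) * (b + c - a) <= b * c) by (apply Rmult_le_compat; lra). lra.
    - nra. }
  lra. }
destruct (Rle_dec b a), (Rle_dec c a), (Rle_dec b c).
all: first [assert (h := Z a b c ltac:(lra) ltac:(lra) ltac:(lra) ltac:(lra) ltac:(lra)); lra
  | assert (h := Z b a c ltac:(lra) ltac:(lra) ltac:(lra) ltac:(lra) ltac:(lra)); lra
  | assert (h := Z c a b ltac:(lra) ltac:(lra) ltac:(lra) ltac:(lra) ltac:(lra)); lra].
Qed.

Lemma pdet_corner2 p q r s t w :
  third p -> third q -> third r -> third s -> third t -> third w ->
  pdet p q r s t w 1 1 0 0 < 0.
Proof.
unfold third; intros hp hq hr hs ht hw.
replace (pdet p q r s t w 1 1 0 0) with
  (- ((1 + p) * (1 + p) * (1 - w * w)) - 2 * (1 + p) * (q * s + r * t + w * (q * t + r * s))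
   + (q * t - r * s) * (q * t - r * s)) by (unfold pdet, gdet, gminor, gcof; ring).
assert (0 <= (1 + p) * (1 + p) * (1 - w * w)) by (apply Rmult_le_pos; nra).
assert (8 / 3 * (q * s + r * t) <= 2 * (1 + p) * (q * s + r * t + w * (q * t + r * s))).
{ assert (0 <= q * s) by nra. assert (0 <= r * t) by nra.
  assert (0 <= w * (q * t + r * s)) by (apply Rmult_le_pos; nra).
  apply Rmult_le_compat; lra. }
(* The only positive term. Both products x, y lie in [1/9, 1], so (x - y)^2 is at most 8/9 |x - y|,
   which is less than 8/9 (x + y); the factor 8/3 is the least value of 2 (1 + p). *)
assert ((q * t - r * s) * (q * t - r * s) < 8 / 3 * (q * s + r * t)).
{ assert (1 / 9 <= q * t <= 1) by nra. assert (1 / 9 <= r * s <= 1) by nra.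
  assert (1 / 3 * q <= q * s) by nra. assert (1 / 3 * s <= q * s) by nra.
  assert (1 / 3 * r <= r * t) by nra. assert (1 / 3 * t <= r * t) by nra.
  assert (q * t <= (q + t) / 2) by nra. assert (r * s <= (r + s) / 2) by nra.
  set (x := q * t) in *; set (y := r * s) in *; clearbody x y.
  assert ((x - y) * (x - y) < 8 / 9 * (x + y)).
  { destruct (Rle_dec x y).
    - assert ((y - x) * (y - x) <= 8 / 9 * (y - x)) by (apply Rmult_le_compat_r; lra). lra.
    - assert ((x - y) * (x - y) <= 8 / 9 * (x - y)) by (apply Rmult_le_compat_r; lra). lra. }
  lra. }
lra.
Qed.

Lemma pdet_corner3 p q r s t w :
  third p -> third q -> third r -> third s -> third t -> third w ->
  pdet p q r s t w 1 1 1 0 < 0.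
Proof.
unfold third; intros hp hq hr hs ht hw.
set (y := 1 + p); set (u := 1 + q); set (v := 1 + s).
replace (pdet p q r s t w 1 1 1 0) with
  (- (2 * y * u * v + 2 * (r * v * (t * u) + r * v * (w * y) + t * u * (w * y))
      - (r * v * (r * v) + t * u * (t * u) + w * y * (w * y))))
  by (unfold pdet, gdet, gminor, gcof, y, u, v; ring).
assert (4 / 3 <= y <= 2) by (unfold y; lra).
assert (4 / 3 <= u <= 2) by (unfold u; lra).
assert (4 / 3 <= v <= 2) by (unfold v; lra).
clearbody y u v.
(* The term 2 y u v exceeds 4 and so compensates the quadratic expression in a, b, c below. *)
assert (2 < y * u * v).
{ assert (16 / 9 <= y * u) by nra. nra. }
assert (4 / 9 <= r * v <= 2) by nra.
assert (4 / 9 <= t * u <= 2) by nra.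
assert (4 / 9 <= w * y <= 2) by nra.
set (a := r * v) in *; set (b := t * u) in *; set (c := w * y) in *; clearbody a b c.
assert (a * a + b * b + c * c - 2 * (a * b + a * c + b * c) < 4).
{ clear - H3 H4 H5. nra. }
lra.
Qed.

(** In one coordinate of z, [pdet] is a quadratic with nonpositive linear term, so its sign on
    [0, 1] is decided at the ends. Doing this coordinate by coordinate reduces a cube to its
    corners. *)
Lemma pdet_lt p q r s t w a b c d :
  third p -> third q -> third r -> third s -> third t -> third w ->
  0 <= b -> 0 <= c -> 0 <= d -> 0 <= a <= 1 ->
  pdet p q r s t w 0 b c d < 0 -> pdet p q r s t w 1 b c d < 0 ->
  pdet p q r s t w a b c d < 0.
Proof.
intros hp hq hr hs ht hw hb hc hd ha h0 h1.
assert (0 <= b * gcof p q r s t w) by (apply Rmult_le_pos; [assumption|apply gcof_ge0; assumption]).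
assert (0 <= c * gcof q p r s w t) by (apply Rmult_le_pos; [assumption|apply gcof_ge0; assumption]).
assert (0 <= d * gcof r p q t w s) by (apply Rmult_le_pos; [assumption|apply gcof_ge0; assumption]).
assert (Q := quad_lt (pdet p q r s t w 0 b c d)
  (- 2 * (b * gcof p q r s t w + c * gcof q p r s w t + d * gcof r p q t w s))
  (- gminor s t w) a).
unfold pdet in *; lra.
Qed.

Lemma pdet_le p q r s t w a b c d :
  third p -> third q -> third r -> third s -> third t -> third w ->
  0 <= b -> 0 <= c -> 0 <= d -> 0 <= a <= 1 ->
  pdet p q r s t w 0 b c d <= 0 -> pdet p q r s t w 1 b c d <= 0 ->
  pdet p q r s t w a b c d <= 0.
Proof.
intros hp hq hr hs ht hw hb hc hd ha h0 h1.
assert (0 <= b * gcof p q r s t w) by (apply Rmult_le_pos; [assumption|apply gcof_ge0; assumption]).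
assert (0 <= c * gcof q p r s w t) by (apply Rmult_le_pos; [assumption|apply gcof_ge0; assumption]).
assert (0 <= d * gcof r p q t w s) by (apply Rmult_le_pos; [assumption|apply gcof_ge0; assumption]).
assert (Q := quad_le (pdet p q r s t w 0 b c d)
  (- 2 * (b * gcof p q r s t w + c * gcof q p r s w t + d * gcof r p q t w s))
  (- gminor s t w) a).
unfold pdet in *; lra.
Qed.

(** The transpositions bring any coordinate of z to the first place, where [pdet_lt] and [pdet_le]
    act. *)
Lemma pdet_swap12 p q r s t w a b c d :
  pdet p q r s t w a b c d = pdet p s t q r w b a c d.
Proof. unfold pdet, gdet, gminor, gcof; ring. Qed.

Lemma pdet_swap13 p q r s t w a b c d :
  pdet p q r s t w a b c d = pdet s q w p t r c b a d.
Proof. unfold pdet, gdet, gminor, gcof; ring. Qed.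

Lemma pdet_swap14 p q r s t w a b c d :
  pdet p q r s t w a b c d = pdet t w r s p q d b c a.
Proof. unfold pdet, gdet, gminor, gcof; ring. Qed.

Lemma pdet_corner p q r s t w a b c d :
  third p -> third q -> third r -> third s -> third t -> third w ->
  a = 0 \/ a = 1 -> b = 0 \/ b = 1 -> c = 0 \/ c = 1 -> d = 0 \/ d = 1 ->
  0 < a + b + c + d -> pdet p q r s t w a b c d < 0.
Proof.
intros hp hq hr hs ht hw [->| ->] [->| ->] [->| ->] [->| ->] h0;
  try (exfalso; lra).
- assert (h := pdet_corner1 t w r s p q ht hw hr hs hp hq). unfold pdet, gdet, gminor in *; lra.
- assert (h := pdet_corner1 s q w p t r hs hq hw hp ht hr). unfold pdet, gdet, gminor in *; lra.
- assert (h := pdet_corner2 w q s r t p hw hq hs hr ht hp). unfold pdet, gdet, gminor, gcof in *; lra.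
- assert (h := pdet_corner1 p s t q r w hp hs ht hq hr hw). unfold pdet, gdet, gminor in *; lra.
- assert (h := pdet_corner2 t p s r w q ht hp hs hr hw hq). unfold pdet, gdet, gminor, gcof in *; lra.
- assert (h := pdet_corner2 s p t q w r hs hp ht hq hw hr). unfold pdet, gdet, gminor, gcof in *; lra.
- assert (h := pdet_corner3 t s p w r q ht hs hp hw hr hq). unfold pdet, gdet, gminor, gcof in *; lra.
- assert (h := pdet_corner1 p q r s t w hp hq hr hs ht hw). unfold pdet, gdet, gminor in *; lra.
- assert (h := pdet_corner2 r p q t w s hr hp hq ht hw hs). unfold pdet, gdet, gminor, gcof in *; lra.
- assert (h := pdet_corner2 q p r s w t hq hp hr hs hw ht). unfold pdet, gdet, gminor, gcof in *; lra.
- assert (h := pdet_corner3 r q p w t s hr hq hp hw ht hs). unfold pdet, gdet, gminor, gcof in *; lra.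
- exact (pdet_corner2 p q r s t w hp hq hr hs ht hw).
- assert (h := pdet_corner3 p r q t s w hp hr hq ht hs hw). unfold pdet, gdet, gminor, gcof in *; lra.
- exact (pdet_corner3 p q r s t w hp hq hr hs ht hw).
- exact (pdet_corner4 p q r s t w hp hq hr hs ht hw).
Qed.

(** The origin is the only corner of the cube where [pdet] may vanish. Hence the face a = 1 is
    strictly negative and the face a = 0 only weakly so; a > 0 restores strictness through
    [quad_neg]. *)
Lemma pdet_neg p q r s t w a b c d :
  third p -> third q -> third r -> third s -> third t -> third w ->
  0 < a <= 1 -> 0 < b <= 1 -> 0 < c <= 1 -> 0 < d <= 1 ->
  pdet p q r s t w a b c d < 0.
Proof.
intros hp hq hr hs ht hw ha hb hc hd.
assert (K := fun a b c d => pdet_corner p q r s t w a b c d hp hq hr hs ht hw).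
assert (h1 : pdet p q r s t w 1 b c d < 0).
{ rewrite pdet_swap12; apply pdet_lt; try assumption; try lra; rewrite <- pdet_swap12;
  rewrite pdet_swap13; (apply pdet_lt; try assumption; try lra); rewrite <- pdet_swap13;
  rewrite pdet_swap14; (apply pdet_lt; try assumption; try lra); rewrite <- pdet_swap14;
  apply K; lra. }
assert (K0 : pdet p q r s t w 0 0 0 0 <= 0).
{ assert (h := gdet_third_le0 p q r s t w hp hq hr hs ht hw); unfold pdet; lra. }
assert (h0 : pdet p q r s t w 0 b c d <= 0).
{ rewrite pdet_swap12; apply pdet_le; try assumption; try lra; rewrite <- pdet_swap12;
  rewrite pdet_swap13; (apply pdet_le; try assumption; try lra); rewrite <- pdet_swap13;
  rewrite pdet_swap14; (apply pdet_le; try assumption; try lra); rewrite <- pdet_swap14;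
  first [exact K0 | apply Rlt_le, K; lra]. }
assert (0 <= b * gcof p q r s t w) by (apply Rmult_le_pos; [lra|apply gcof_ge0; assumption]).
assert (0 <= c * gcof q p r s w t) by (apply Rmult_le_pos; [lra|apply gcof_ge0; assumption]).
assert (0 <= d * gcof r p q t w s) by (apply Rmult_le_pos; [lra|apply gcof_ge0; assumption]).
assert (Q := quad_neg (pdet p q r s t w 0 b c d)
  (- 2 * (b * gcof p q r s t w + c * gcof q p r s w t + d * gcof r p q t w s))
  (- gminor s t w) a).
unfold pdet in *; lra.
Qed.

(* cosh of the length of an edge of weight k = cos Phi whose ends have radii with
   hyperbolic sines sa, sb and cosines ca, cb. *)
Definition packed (sa ca sb cb k : R) : R := sa * sb + k * ca * cb.

(* Dividing row and column a of G by cosh r_a turns G into K - z z^T with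
   z_a = tanh r_a. *)
Lemma gdet_packed_neg p q r s t w s1 s2 s3 s4 c1 c2 c3 c4 :
  third p -> third q -> third r -> third s -> third t -> third w ->
  0 < s1 -> 0 < s2 -> 0 < s3 -> 0 < s4 ->
  0 < c1 -> 0 < c2 -> 0 < c3 -> 0 < c4 ->
  c1 * c1 - s1 * s1 = 1 -> c2 * c2 - s2 * s2 = 1 -> c3 * c3 - s3 * s3 = 1 -> c4 * c4 - s4 * s4 = 1 ->
  gdet (packed s1 c1 s2 c2 p) (packed s1 c1 s3 c3 q) (packed s1 c1 s4 c4 r)
    (packed s2 c2 s3 c3 s) (packed s2 c2 s4 c4 t) (packed s3 c3 s4 c4 w) < 0.
Proof.
intros hp hq hr hs ht hw hs1 hs2 hs3 hs4 hc1 hc2 hc3 hc4 e1 e2 e3 e4.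
assert (B : forall u v, 0 < u -> 0 < v -> v * v - u * u = 1 -> 0 < u / v <= 1).
{ intros u v hu hv e; split; [apply Rdiv_lt_0_compat; assumption|].
  apply (Rmult_le_reg_r v); [assumption|]. unfold Rdiv; rewrite -> Rmult_assoc, Rinv_l by lra. nra. }
assert (N := pdet_neg p q r s t w (s1 / c1) (s2 / c2) (s3 / c3) (s4 / c4) hp hq hr hs ht hw
  (B _ _ hs1 hc1 e1) (B _ _ hs2 hc2 e2) (B _ _ hs3 hc3 e3) (B _ _ hs4 hc4 e4)).
assert (E : gdet (packed s1 c1 s2 c2 p) (packed s1 c1 s3 c3 q) (packed s1 c1 s4 c4 r)
    (packed s2 c2 s3 c3 s) (packed s2 c2 s4 c4 t) (packed s3 c3 s4 c4 w)
  = (c1 * c1) * (c2 * c2) * (c3 * c3) * (c4 * c4)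
    * pdet p q r s t w (s1 / c1) (s2 / c2) (s3 / c3) (s4 / c4)).
{ transitivity ((c1 * c1) * (c2 * c2) * (c3 * c3) * (c4 * c4) * gdet p q r s t w
   - s1 * s1 * ((c2 * c2) * (c3 * c3) * (c4 * c4)) * gminor s t w
   - s2 * s2 * ((c1 * c1) * (c3 * c3) * (c4 * c4)) * gminor q r w
   - s3 * s3 * ((c1 * c1) * (c2 * c2) * (c4 * c4)) * gminor p r t
   - s4 * s4 * ((c1 * c1) * (c2 * c2) * (c3 * c3)) * gminor p q s
   - 2 * c1 * c2 * c3 * c4 * (s1 * s2 * c3 * c4 * gcof p q r s t w
      + s1 * s3 * c2 * c4 * gcof q p r s w t + s1 * s4 * c2 * c3 * gcof r p q t w s
      + s2 * s3 * c1 * c4 * gcof s p t q w r + s2 * s4 * c1 * c3 * gcof t p s r w q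
      + s3 * s4 * c1 * c2 * gcof w q s r t p)).
  2: unfold pdet; field; lra.
  (* Homogenization: the diagonal entries 1 become c^2 - s^2, after which both sides agree as
     polynomials. *)
  assert (H : forall p q r s t w d1 d2 d3 d4, d1 = 1 -> d2 = 1 -> d3 = 1 -> d4 = 1 ->
    gdet p q r s t w = d1 * d2 * d3 * d4
      - d3 * d4 * p * p - d2 * d4 * q * q - d2 * d3 * r * r
      - d1 * d4 * s * s - d1 * d3 * t * t - d1 * d2 * w * w
      + p * p * w * w + q * q * t * t + r * r * s * s
      - 2 * (d4 * p * q * s + d3 * p * r * t + d2 * q * r * w + d1 * s * t * w)
      - 2 * (p * w * q * t + p * w * r * s + q * t * r * s)).
  { clear; intros p q r s t w d1 d2 d3 d4 -> -> -> ->; unfold gdet; ring. }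
  rewrite (H _ _ _ _ _ _ _ _ _ _ e1 e2 e3 e4).
  unfold packed, gdet, gminor, gcof; ring. }
rewrite E.
assert (0 < (c1 * c1) * (c2 * c2) * (c3 * c3) * (c4 * c4))
  by (repeat apply Rmult_lt_0_compat; assumption).
nra.
Qed.

(** * Positivity at a regular tetrahedron *)

Lemma angrow_regular x P Q R' S T W : 1 < x ->
  angrow x x x x x x P Q R' S T W =
  W - x / (2 * x - 1) * (Q + R' + S + T) + 2 * x * x / ((2 * x - 1) * (x - 1)) * P.
Proof.
intros hx; unfold angrow, kap.
replace (gminor x x x) with ((1 + x) * (1 + x) * (1 - 2 * x)) by (unfold gminor; ring).
replace (gcof x x x x x x) with (x * (1 + x) * (1 + x)) by (unfold gcof; ring).
replace (gdet x x x x x x) with ((1 - 3 * x) * ((1 + x) * (1 + x) * (1 + x))) by (unfold gdet; ring).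
replace (1 - x * x) with ((1 - x) * (1 + x)) by ring.
field; repeat split; lra.
Qed.

Definition angform x12 x13 x14 x23 x24 x34 y12 y13 y14 y23 y24 y34 : R :=
  y12 * angrow x12 x13 x14 x23 x24 x34 y12 y13 y14 y23 y24 y34 +
  y13 * angrow x13 x12 x14 x23 x34 x24 y13 y12 y14 y23 y34 y24 +
  y14 * angrow x14 x12 x13 x24 x34 x23 y14 y12 y13 y24 y34 y23 +
  y23 * angrow x23 x12 x24 x13 x34 x14 y23 y12 y24 y13 y34 y14 +
  y24 * angrow x24 x12 x23 x14 x34 x13 y24 y12 y23 y14 y34 y13 +
  y34 * angrow x34 x13 x23 x14 x24 x12 y34 y13 y23 y14 y24 y12.

(** The symmetry suggests the coordinates: differences and sums over the three pairs of opposite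
    edges. In them the form is a sum of squares with the positive weights k - 1, k + 1 - 4 rho and
    rho. *)
Lemma angform_regular x y12 y13 y14 y23 y24 y34 : 1 < x ->
  0 <= angform x x x x x x y12 y13 y14 y23 y24 y34 /\
  (angform x x x x x x y12 y13 y14 y23 y24 y34 = 0 ->
   y12 = 0 /\ y13 = 0 /\ y14 = 0 /\ y23 = 0 /\ y24 = 0 /\ y34 = 0).
Proof.
intros hx; unfold angform; rewrite -> !angrow_regular by assumption.
set (rho := x / (2 * x - 1)); set (k := 2 * x * x / ((2 * x - 1) * (x - 1))).
assert (hr : 0 < rho) by (apply Rdiv_lt_0_compat; lra).
assert (hk1 : 0 < k - 1).
{ replace (k - 1) with ((3 * x - 1) / ((2 * x - 1) * (x - 1))) by (unfold k; field; lra).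
  apply Rdiv_lt_0_compat; [lra|apply Rmult_lt_0_compat; lra]. }
assert (hk4 : 0 < k + 1 - 4 * rho).
{ replace (k + 1 - 4 * rho) with ((x + 1) / ((2 * x - 1) * (x - 1))) by (unfold k, rho; field; lra).
  apply Rdiv_lt_0_compat; [lra|apply Rmult_lt_0_compat; lra]. }
clearbody rho k.
match goal with |- 0 <= ?f /\ _ => replace f with
  (/ 2 * ((k - 1) * ((y12 - y34) * (y12 - y34) + (y13 - y24) * (y13 - y24) + (y14 - y23) * (y14 - y23))
   + (k + 1 - 4 * rho) * ((y12 + y34) * (y12 + y34) + (y13 + y24) * (y13 + y24) + (y14 + y23) * (y14 + y23)))
   + rho * ((y12 + y34 - y13 - y24) * (y12 + y34 - y13 - y24)
     + (y12 + y34 - y14 - y23) * (y12 + y34 - y14 - y23)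
     + (y13 + y24 - y14 - y23) * (y13 + y24 - y14 - y23))) by field end.
assert (SQ : forall a, 0 <= a * a) by (intros; apply Rle_0_sqr).
assert (S3 : forall a b c, 0 <= a * a + b * b + c * c /\
   (a * a + b * b + c * c = 0 -> a = 0 /\ b = 0 /\ c = 0)).
{ intros a b c; split; [pose proof (SQ a); pose proof (SQ b); pose proof (SQ c); lra|].
  intros h; assert (a * a = 0 /\ b * b = 0 /\ c * c = 0) as (ea & eb & ec)
    by (pose proof (SQ a); pose proof (SQ b); pose proof (SQ c); lra).
  repeat split; apply Rsqr_0_uniq; assumption. }
destruct (S3 (y12 - y34) (y13 - y24) (y14 - y23)) as [n1 z1].
destruct (S3 (y12 + y34) (y13 + y24) (y14 + y23)) as [n2 z2].
destruct (S3 (y12 + y34 - y13 - y24) (y12 + y34 - y14 - y23) (y13 + y24 - y14 - y23)) as [n3 _].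
set (A := (y12 - y34) * _ + _ + _) in *.
set (B := (y12 + y34) * (y12 + y34) + _ + _) in *.
set (C := (y12 + y34 - y13 - y24) * _ + _ + _) in *.
assert (m1 := Rmult_le_pos _ _ (Rlt_le _ _ hk1) n1).
assert (m2 := Rmult_le_pos _ _ (Rlt_le _ _ hk4) n2).
assert (m3 := Rmult_le_pos _ _ (Rlt_le _ _ hr) n3).
split; [lra|intros h].
assert (eA : (k - 1) * A = 0) by lra. assert (eB : (k + 1 - 4 * rho) * B = 0) by lra.
apply Rmult_integral in eA; apply Rmult_integral in eB.
destruct z1 as (? & ? & ?); [lra|]. destruct z2 as (? & ? & ?); [lra|]. lra.
Qed.

(** * Dihedral angles as functions of the edge lengths *)

(** The edge ab lies on the faces opposite to c and d, hence the cofactor at (c, d). Both minors are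
    negative, so their product has a root. *)
Definition angle (p q r s t w : R) : R :=
  acos (gcof w q s r t p / sqrt (gminor p r t * gminor p q s)).

Ltac dlim :=
  match goal with
  | |- derivable_pt_lim (fun x => @?f x + @?g x) _ _ =>
      eapply (derivable_pt_lim_plus f g); dlim
  | |- derivable_pt_lim (fun x => @?f x - @?g x) _ _ =>
      eapply (derivable_pt_lim_minus f g); dlim
  | |- derivable_pt_lim (fun x => @?f x * @?g x) _ _ =>
      eapply (derivable_pt_lim_mult f g); dlim
  | |- derivable_pt_lim (fun x => ?c) _ _ => apply (derivable_pt_lim_const c)
  | |- _ => eassumption
  end.

Lemma derivable_pt_lim_eq f x l l' : derivable_pt_lim f x l' -> l = l' -> derivable_pt_lim f x l.
Proof. intros h ->; exact h. Qed.

Lemma derivable_pt_lim_acos u : -1 < u < 1 -> derivable_pt_lim acos u (- / sqrt (1 - u * u)).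
Proof.
intros hu.
apply derivable_pt_lim_eq with (1 := derive_pt_eq_1 _ _ _ _ (derive_pt_acos u hu)).
unfold Rsqr; field. apply Rgt_not_eq, sqrt_lt_R0; nra.
Qed.

Lemma gminor_deriv p q s P Q S x :
  derivable_pt_lim p x P -> derivable_pt_lim q x Q -> derivable_pt_lim s x S ->
  derivable_pt_lim (fun x => gminor (p x) (q x) (s x)) x (dgminor (p x) (q x) (s x) P Q S).
Proof.
intros; unfold gminor; eapply derivable_pt_lim_eq; [dlim|unfold dgminor; ring].
Qed.

Lemma gcof_deriv p q r s t w P Q R' S T W x :
  derivable_pt_lim p x P -> derivable_pt_lim q x Q -> derivable_pt_lim r x R' ->
  derivable_pt_lim s x S -> derivable_pt_lim t x T -> derivable_pt_lim w x W ->
  derivable_pt_lim (fun x => gcof (p x) (q x) (r x) (s x) (t x) (w x)) x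
    (dgcof (p x) (q x) (r x) (s x) (t x) (w x) P Q R' S T W).
Proof.
intros; unfold gcof; eapply derivable_pt_lim_eq; [dlim|unfold dgcof; ring].
Qed.

(** With p = cosh l_ab the first factor is sinh l_ab over a root common to all edges. Since d(cosh
    l) = sinh l dl, pairing the angle differentials with dl gives the symmetric form [angform] in
    the variables sinh l dl: this is the diagonal congruence. *)
Lemma angle_deriv p q r s t w P Q R' S T W x :
  derivable_pt_lim p x P -> derivable_pt_lim q x Q -> derivable_pt_lim r x R' ->
  derivable_pt_lim s x S -> derivable_pt_lim t x T -> derivable_pt_lim w x W ->
  1 < p x -> 1 < q x -> 1 < r x -> 1 < s x -> 1 < t x -> 1 < w x ->
  gdet (p x) (q x) (r x) (s x) (t x) (w x) < 0 ->
  derivable_pt_lim (fun x => angle (p x) (q x) (r x) (s x) (t x) (w x)) x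
    (sqrt (p x * p x - 1) / sqrt (- gdet (p x) (q x) (r x) (s x) (t x) (w x))
      * angrow (p x) (q x) (r x) (s x) (t x) (w x) P Q R' S T W).
Proof.
intros dp dq dr ds dt dw hp hq hr hs ht hw hD.
set (Mc := fun x => gminor (p x) (r x) (t x)); set (Md := fun x => gminor (p x) (q x) (s x)).
set (C := fun x => gcof (w x) (q x) (s x) (r x) (t x) (p x)).
assert (dMc : derivable_pt_lim Mc x (dgminor (p x) (r x) (t x) P R' T)) by (apply gminor_deriv; assumption).
assert (dMd : derivable_pt_lim Md x (dgminor (p x) (q x) (s x) P Q S)) by (apply gminor_deriv; assumption).
assert (dC : derivable_pt_lim C x (dgcof (w x) (q x) (s x) (r x) (t x) (p x) W Q S R' T P))
  by (apply gcof_deriv; assumption).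
assert (hMc : Mc x < 0) by (apply gminor_neg; assumption).
assert (hMd : Md x < 0) by (apply gminor_neg; assumption).
assert (J := gjacobi (p x) (q x) (r x) (s x) (t x) (w x)).
assert (E := angrow_eq (p x) (q x) (r x) (s x) (t x) (w x) P Q R' S T W
  (Rlt_not_eq _ _ hMc) (Rlt_not_eq _ _ hMd) (Rlt_not_eq _ _ hD)).
fold (Mc x) (Md x) (C x) in J, E.
set (D := gdet (p x) (q x) (r x) (s x) (t x) (w x)) in *.
set (row := angrow (p x) _ _ _ _ _ _ _ _ _ _ _) in *.
set (C' := dgcof _ _ _ _ _ _ _ _ _ _ _ _) in *.
set (Mc' := dgminor (p x) (r x) (t x) P R' T) in *; set (Md' := dgminor (p x) (q x) (s x) P Q S) in *.
assert (hp2 : 0 < p x * p x - 1) by nra.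
specialize (E ltac:(apply Rlt_not_eq; lra)).
assert (hm : 0 < Mc x * Md x) by nra.
assert (hK : 0 < D * (1 - p x * p x)) by nra.
assert (sm := sqrt_lt_R0 _ hm); assert (sm2 := sqrt_def _ (Rlt_le _ _ hm)).
set (rm := sqrt (Mc x * Md x)) in *.
(* By [gjacobi]; the right side is positive, so [acos] is differentiable here. *)
assert (eu : 1 - C x / rm * (C x / rm) = D * (1 - p x * p x) / (rm * rm)).
{ rewrite <- J, <- sm2. field; lra. }
assert (hu : -1 < C x / rm < 1).
{ assert (0 < D * (1 - p x * p x) / (rm * rm))
    by (apply Rdiv_lt_0_compat; [exact hK|apply Rmult_lt_0_compat; exact sm]).
  split; nra. }
assert (dm : derivable_pt_lim (fun x => sqrt (Mc x * Md x)) x (/ (2 * rm) * (Mc' * Md x + Mc x * Md'))).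
{ apply (derivable_pt_lim_comp (fun x => Mc x * Md x) sqrt).
  - apply (derivable_pt_lim_mult Mc Md); [exact dMc|exact dMd].
  - apply derivable_pt_lim_sqrt; assumption. }
assert (du := derivable_pt_lim_div C (fun x => sqrt (Mc x * Md x)) x _ _ dC dm (Rgt_not_eq _ _ sm)).
assert (da := derivable_pt_lim_comp _ acos x _ _ du (derivable_pt_lim_acos (C x / rm) hu)).
apply derivable_pt_lim_eq with (1 := da).
fold rm. rewrite eu.
assert (sK : sqrt (D * (1 - p x * p x) / (rm * rm)) = sqrt (p x * p x - 1) * sqrt (- D) / rm).
{ replace (D * (1 - p x * p x)) with ((p x * p x - 1) * (- D)) by ring.
  rewrite -> sqrt_div by nra. rewrite -> sqrt_square by lra. rewrite -> sqrt_mult by lra. reflexivity. }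
rewrite sK.
assert (sD : 0 < sqrt (- D)) by (apply sqrt_lt_R0; lra).
assert (sp : 0 < sqrt (p x * p x - 1)) by (apply sqrt_lt_R0; lra).
assert (sp2 := sqrt_def (p x * p x - 1) (Rlt_le _ _ hp2)).
set (a := sqrt (p x * p x - 1)) in *; set (b := sqrt (- D)) in *.
transitivity (- (C' - / 2 * C x * (Mc' / Mc x + Md' / Md x)) / (a * b)).
- rewrite E. replace (1 - p x * p x) with (- (a * a)) by lra. field; lra.
- unfold Rsqr. transitivity (- (C' - / 2 * C x * (Mc' * Md x + Mc x * Md') / (rm * rm)) / (a * b)).
  + rewrite sm2. field; lra.
  + field; lra.
Qed.

(** Contrapositive form of positive definiteness, matching the nonpositive derivative that the mean
    value theorem yields. *)
Definition angform_posdef x12 x13 x14 x23 x24 x34 := forall y12 y13 y14 y23 y24 y34,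
  angform x12 x13 x14 x23 x24 x34 y12 y13 y14 y23 y24 y34 <= 0 ->
  y12 = 0 /\ y13 = 0 /\ y14 = 0 /\ y23 = 0 /\ y24 = 0 /\ y34 = 0.

Lemma cosh2_sinh2 x : cosh x * cosh x - sinh x * sinh x = 1.
Proof.
unfold cosh, sinh.
assert (h : exp x * exp (- x) = 1) by (rewrite <- exp_plus, Rplus_opp_r; apply exp_0).
transitivity (exp x * exp (- x)); [field|exact h].
Qed.

Lemma cosh_pos x : 0 < cosh x.
Proof. unfold cosh; assert (h := exp_pos x); assert (h' := exp_pos (- x)); lra. Qed.

Lemma sinh_pos x : 0 < x -> 0 < sinh x.
Proof. intros h; rewrite <- sinh_0; apply sinh_lt, h. Qed.

Lemma cosh_gt1 x : 0 < x -> 1 < cosh x.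
Proof.
intros hx; assert (h := cosh2_sinh2 x); assert (c := cosh_pos x); assert (s := sinh_pos x hx).
nra.
Qed.

(** The leading minors then have signs +, -, -, -, so G has signature (3, 1). *)
Definition hyper_gram (x12 x13 x14 x23 x24 x34 : R) :=
  (1 < x12 /\ 1 < x13 /\ 1 < x14 /\ 1 < x23 /\ 1 < x24 /\ 1 < x34) /\
  gdet x12 x13 x14 x23 x24 x34 < 0.

Definition angle_pairing x12 x13 x14 x23 x24 x34 d12 d13 d14 d23 d24 d34 :=
  angle x12 x13 x14 x23 x24 x34 * d12 + angle x13 x12 x14 x23 x34 x24 * d13 +
  angle x14 x12 x13 x24 x34 x23 * d14 + angle x23 x12 x24 x13 x34 x14 * d23 +
  angle x24 x12 x23 x14 x34 x13 * d24 + angle x34 x13 x23 x14 x24 x12 * d34.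

(** Along the segment l + s d, the derivative of the pairing of the angles with d is [angform] at
    the vector sinh (l + s d) d, over a positive root. If the pairing does not increase, this is
    nonpositive at some s, so the vector vanishes, and d with it because sinh is positive. *)
Lemma angle_pairing_pos l12 l13 l14 l23 l24 l34 d12 d13 d14 d23 d24 d34 :
  (forall s, 0 <= s <= 1 -> 0 < l12 + s * d12 /\ 0 < l13 + s * d13 /\ 0 < l14 + s * d14 /\
     0 < l23 + s * d23 /\ 0 < l24 + s * d24 /\ 0 < l34 + s * d34) ->
  (forall s, 0 <= s <= 1 ->
     gdet (cosh (l12 + s * d12)) (cosh (l13 + s * d13)) (cosh (l14 + s * d14))
       (cosh (l23 + s * d23)) (cosh (l24 + s * d24)) (cosh (l34 + s * d34)) < 0) ->
  (forall s, 0 <= s <= 1 ->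
     angform_posdef (cosh (l12 + s * d12)) (cosh (l13 + s * d13)) (cosh (l14 + s * d14))
       (cosh (l23 + s * d23)) (cosh (l24 + s * d24)) (cosh (l34 + s * d34))) ->
  angle_pairing (cosh (l12 + d12)) (cosh (l13 + d13)) (cosh (l14 + d14))
       (cosh (l23 + d23)) (cosh (l24 + d24)) (cosh (l34 + d34)) d12 d13 d14 d23 d24 d34
  <= angle_pairing (cosh l12) (cosh l13) (cosh l14) (cosh l23) (cosh l24) (cosh l34)
       d12 d13 d14 d23 d24 d34 ->
  d12 = 0 /\ d13 = 0 /\ d14 = 0 /\ d23 = 0 /\ d24 = 0 /\ d34 = 0.
Proof.
intros hl hD hpos.
set (x := fun l d s => cosh (l + s * d)).
set (Phi := fun s => angle_pairing (x l12 d12 s) (x l13 d13 s) (x l14 d14 s)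
  (x l23 d23 s) (x l24 d24 s) (x l34 d34 s) d12 d13 d14 d23 d24 d34).
intros hle; assert (hle' : Phi 1 <= Phi 0).
{ unfold Phi, x. rewrite !Rmult_1_l !Rmult_0_l !Rplus_0_r. exact hle. }
clear hle.
assert (dx : forall l d s, derivable_pt_lim (x l d) s (sinh (l + s * d) * d)).
{ intros l d s. apply (derivable_pt_lim_comp (fun s => l + s * d) cosh).
  - eapply derivable_pt_lim_eq; [|]. 
    eapply (derivable_pt_lim_plus (fun _ => l) (fun s => s * d));
      [apply derivable_pt_lim_const|eapply (derivable_pt_lim_mult id (fun _ => d));
        [apply derivable_pt_lim_id|apply derivable_pt_lim_const]].
    ring.
  - apply derivable_pt_lim_cosh. }
assert (hx : forall l d s, 0 < l + s * d -> 1 < x l d s) by (intros; apply cosh_gt1; assumption).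
assert (hs : forall l d s, 0 < l + s * d -> sqrt (x l d s * x l d s - 1) = sinh (l + s * d)).
{ intros l d s h. unfold x.
  replace (cosh (l + s * d) * cosh (l + s * d) - 1) with (sinh (l + s * d) * sinh (l + s * d))
    by (assert (e := cosh2_sinh2 (l + s * d)); lra).
  apply sqrt_square, Rlt_le, sinh_pos, h. }
set (y := fun l d s => sinh (l + s * d) * d).
set (Phi' := fun s =>
  angform (x l12 d12 s) (x l13 d13 s) (x l14 d14 s) (x l23 d23 s) (x l24 d24 s) (x l34 d34 s)
   (y l12 d12 s) (y l13 d13 s) (y l14 d14 s) (y l23 d23 s) (y l24 d24 s) (y l34 d34 s)
  / sqrt (- gdet (x l12 d12 s) (x l13 d13 s) (x l14 d14 s) (x l23 d23 s) (x l24 d24 s) (x l34 d34 s))).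
destruct (MVT_cor2 Phi Phi' 0 1) as (c & hc & hc01); [lra| |].
- intros s hs01. destruct (hl s hs01) as (h12 & h13 & h14 & h23 & h24 & h34).
  specialize (hD s hs01).
  unfold Phi, angle_pairing.
  eapply derivable_pt_lim_eq.
  { repeat (match goal with |- derivable_pt_lim (fun x => @?f x + @?g x) _ _ =>
      apply (derivable_pt_lim_plus f g) end).
    all: match goal with |- derivable_pt_lim (fun x => @?f x * ?d) _ _ =>
      apply (derivable_pt_lim_mult f (fun _ => d)); [|apply (derivable_pt_lim_const d)] end.
    all: apply angle_deriv; try apply dx; try (apply hx; assumption); fold (x l12 d12 s) in *;
      unfold x, gdet in *; lra. }
  cbv beta.
    destruct (gdet_views (x l12 d12 s) (x l13 d13 s) (x l14 d14 s) (x l23 d23 s) (x l24 d24 s) (x l34 d34 s))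
      as (-> & -> & -> & -> & ->).
    rewrite -> !hs by assumption.
    unfold Phi', angform, y.
    assert (0 < sqrt (- gdet (x l12 d12 s) (x l13 d13 s) (x l14 d14 s) (x l23 d23 s) (x l24 d24 s) (x l34 d34 s)))
      by (apply sqrt_lt_R0; unfold x; lra).
    field; lra.
- destruct (hl c ltac:(lra)) as (h12 & h13 & h14 & h23 & h24 & h34).
  specialize (hD c ltac:(lra)).
  assert (sD : 0 < sqrt (- gdet (x l12 d12 c) (x l13 d13 c) (x l14 d14 c) (x l23 d23 c) (x l24 d24 c) (x l34 d34 c)))
      by (apply sqrt_lt_R0; unfold x; lra).
  destruct (hpos c ltac:(lra) (y l12 d12 c) (y l13 d13 c) (y l14 d14 c) (y l23 d23 c) (y l24 d24 c) (y l34 d34 c))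
    as (z12 & z13 & z14 & z23 & z24 & z34).
  + assert (h : Phi' c <= 0) by lra. unfold Phi' in h.
    apply (Rmult_le_compat_r _ _ _ (Rlt_le _ _ sD)) in h.
    unfold Rdiv in h; rewrite -> Rmult_assoc, Rinv_l, Rmult_1_r, Rmult_0_l in h by lra. exact h.
  + assert (Z : forall l d, 0 < l + c * d -> y l d c = 0 -> d = 0).
    { intros l d h e; unfold y in e. apply Rmult_integral in e. destruct e as [e|e]; [|exact e].
      assert (k := sinh_pos _ h). lra. }
    repeat split; eapply Z; eassumption.
Qed.

Set Implicit Arguments.
Unset Strict Implicit.
Unset Printing Implicit Defensive.

(** * Positive definiteness along paths of symmetric matrices *)

Section QuadraticForms.
Import mathcomp.classical.all_classical mathcomp.analysis.all_analysis.
Import mathcomp.algebra_tactics.ring mathcomp.algebra_tactics.lra.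
Import Order.TTheory GRing.Theory Num.Theory.
Import numFieldTopology.Exports numFieldNormedType.Exports.
Local Open Scope classical_set_scope.
Local Open Scope ring_scope.

Definition qform (K : comNzRingType) n (M : 'M[K]_n) (v : 'rV[K]_n) : K :=
  (v *m M *m v^T) 0 0.

Lemma qformE (K : comNzRingType) n (M : 'M[K]_n) (v : 'rV[K]_n) :
  qform M v = \sum_j \sum_i v 0 i * M i j * v 0 j.
Proof.
rewrite /qform mxE; apply: eq_bigr => j _.
by rewrite !mxE big_distrl.
Qed.

Lemma qformZ (K : comNzRingType) n (M : 'M[K]_n) a (v : 'rV[K]_n) :
  qform M (a *: v) = a ^+ 2 * qform M v.
Proof. by rewrite /qform linearZ /= -scalemxAr -!scalemxAl !mxE mulrA expr2. Qed.

Lemma qformDZ (K : comNzRingType) n (M : 'M[K]_n) a (u v : 'rV[K]_n) :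
  M^T = M ->
  qform M (u + a *: v) =
    qform M u + a *+ 2 * (u *m M *m v^T) 0 0 + a ^+ 2 * qform M v.
Proof.
move=> Msym; have e : (v *m M *m u^T) 0 0 = (u *m M *m v^T) 0 0.
  rewrite -[v *m M *m u^T]trmxK (mxE trmx_key) !trmx_mul !trmxK.
  by rewrite Msym mulmxA.
rewrite /qform linearD linearZ /= mulmxDr !mulmxDl -!scalemxAr -!scalemxAl.
by rewrite !mxE in e *; rewrite e; ring.
Qed.

Definition posdef (K : numDomainType) n (M : 'M[K]_n) :=
  forall v, v != 0 -> 0 < qform M v.

(** Otherwise a small step from v against its image v M would make the form negative. *)
Lemma psd_null_kernel (K : realFieldType) n (M : 'M[K]_n) (v : 'rV[K]_n) :
  M^T = M -> (forall u, 0 <= qform M u) -> qform M v = 0 -> v *m M = 0.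
Proof.
move=> Msym psd qv0.
set w := v *m M; set b := \sum_j w 0 j ^+ 2.
have bE : (v *m M *m w^T) 0 0 = b.
  by rewrite mxE; apply: eq_bigr => j _; rewrite !mxE expr2.
have b0 : b = 0.
  (* With q the form at w, the value here is -b^2 (q + 2) / (q + 1)^2; adding 1 to q keeps the step
     defined when q = 0. *)
  have := psd (v + (- b / (qform M w + 1)) *: w).
  rewrite qformDZ // qv0 bE add0r; have := psd w; set q := qform M w => qw h.
  have q1 : 0 < q + 1 by lra.
  have h1 := mulr_ge0 h (ltW (exprn_gt0 2 q1)).
  have e : (- b / (q + 1) *+ 2 * b + (- b / (q + 1)) ^+ 2 * q) * (q + 1) ^+ 2 =
      - (b ^+ 2 * (q + 2)) by field; rewrite gt_eqF.
  move: h1; rewrite e.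
  rewrite oppr_ge0 pmulr_lle0 ?ltr_wpDl ?ltr0n // => b2.
  have : b ^+ 2 == 0 by rewrite eq_le b2 sqr_ge0.
  by rewrite sqrf_eq0 => /eqP.
apply/matrixP => i j; rewrite (ord1 i) [RHS]mxE.
have /(_ j isT)/eqP := psumr_eq0P (fun i _ => sqr_ge0 (w 0 i)) b0.
by rewrite sqrf_eq0 => /eqP.
Qed.

Lemma qform_continuous (R : realType) n (M : R -> 'M[R]_n) :
  (forall i j, continuous (fun t => M t i j)) ->
  continuous (fun x : R * 'rV[R]_n => qform (M x.1) x.2).
Proof.
move=> Mc; under [X in continuous X]funext do rewrite qformE.
apply: (continuous_big add_continuous) => j _.
apply: (continuous_big add_continuous) => i _ x.
have c1 k : {for x, continuous (fun y : R * 'rV[R]_n => y.2 0 k)}.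
  apply: (@continuous_comp _ _ _ snd (fun v : 'rV[R]_n => v 0 k)); first exact: cvg_snd.
  exact: coord_continuous.
apply: cvgM; last exact: c1.
apply: cvgM; first exact: c1.
by apply: (@continuous_comp _ _ _ fst (fun t => M t i j)); [exact: cvg_fst|exact: Mc].
Qed.

Lemma unit_sphere_compact (R : realType) n :
  compact [set v : 'rV[R]_n | \sum_i v 0 i ^+ 2 = 1].
Proof.
have cc : continuous (fun v : 'rV[R]_n => \sum_i v 0 i ^+ 2).
  apply: (continuous_big add_continuous) => i _ v.
  rewrite (_ : (fun _ => _) = (fun v : 'rV[R]_n => v 0 i * v 0 i)); last first.
    by apply: funext => u; rewrite expr2.
  have ci : {for v, continuous (fun v : 'rV[R]_n => v 0 i)} by exact: coord_continuous.
  exact: (cvgM ci ci).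
have cS : closed ((fun v : 'rV[R]_n => \sum_i v 0 i ^+ 2) @^-1` [set x | x = 1]).
  by apply: preimage_closed; [move=> v _; exact: cc|exact: closed_eq].
have cB : compact [set v : 'rV[R]_n | forall i, v 0 i \in `[(-1), 1]%R].
  by apply: (rV_compact (fun i : 'I_n => @segment_compact R (-1) 1)).
apply: (subclosed_compact cS cB) => v /= vS i.
rewrite /= in_itv /= -ler_norml -(@expr_le1 _ 2) // real_normK ?num_real //.
by rewrite -vS (bigD1 i) //= lerDl sumr_ge0 // => j _; exact: sqr_ge0.
Qed.

(* The last time at which the form fails to be positive definite would be a
   time at which it is positive semidefinite with a nonzero null vector. *)
Lemma posdef_transport (R : realType) n (M : R -> 'M[R]_n) :
  (forall t, (M t)^T = M t) ->
  (forall t, 0 <= t <= 1 -> forall i j, {for t, continuous (fun t => M t i j)}) ->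
  (forall t, 0 <= t <= 1 -> forall v : 'rV_n, v *m M t = 0 -> v = 0) ->
  posdef (M 1) -> posdef (M 0).
Proof.
move=> Msym Mc0 Mnd pd1.
(* Clamping the time to [0, 1] makes the family continuous on the whole line. *)
pose cl (t : R) := Num.max 0 (Num.min 1 t).
have clc : continuous cl.
  move=> t; apply: continuous_max; first exact: cst_continuous.
  by apply: continuous_min; [exact: cst_continuous|exact: cvg_id].
have cl01 t : 0 <= cl t <= 1 by rewrite /cl le_max lexx /= ge_max ler01 ge_min lexx.
have clE t : 0 <= t <= 1 -> cl t = t.
  by move=> /andP[t0 t1]; rewrite /cl (min_idPr t1) (max_idPr t0).
pose N t := M (cl t).
have Nc : forall i j, continuous (fun t => N t i j).
  by move=> i j t; apply: (@continuous_comp _ _ _ cl (fun t => M t i j)); [exact: clc|exact: Mc0].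
pose q (x : R * 'rV[R]_n) := qform (N x.1) x.2.
have qc : continuous q by exact: qform_continuous.
pose K := ([set` `[0, 1]] : set R) `*` [set v : 'rV[R]_n | \sum_i v 0 i ^+ 2 = 1].
have Kc : compact K by apply: compact_setX; [exact: segment_compact|exact: unit_sphere_compact].
(* Pairs of a time and a unit vector on which the form is not positive; by compactness there is a
   pair with the latest time. *)
pose A := K `&` (q @^-1` [set x | x <= 0]).
have Ac : compact A.
  apply: (subclosed_compact _ Kc) => //; last by move=> x [].
  apply: closedI; first by apply: compact_closed => //; exact: pseudoMetric_normal_hausdorff.
  by apply: preimage_closed; [move=> x _; exact: qc|exact: closed_le].
have normalize (v : 'rV[R]_n) : v != 0 ->
    exists2 a : R, 0 < a & \sum_i (a *: v) 0 i ^+ 2 = 1.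
  move=> v0; have S0 : 0 < \sum_i v 0 i ^+ 2.
    rewrite lt0r sumr_ge0 ?andbT => [|i _]; last exact: sqr_ge0.
    apply: contra_neq v0 => S0; apply/matrixP => i j; rewrite (ord1 i) [RHS]mxE.
    have /(_ j isT)/eqP := psumr_eq0P (fun i _ => sqr_ge0 (v 0 i)) S0.
    by rewrite sqrf_eq0 => /eqP.
  exists (Num.sqrt (\sum_i v 0 i ^+ 2))^-1; first by rewrite invr_gt0 sqrtr_gt0.
  under eq_bigr do rewrite mxE exprMn.
  by rewrite -mulr_sumr exprVn sqr_sqrtr ?ltW // mulVf // gt_eqF.
move=> v v0; rewrite ltNge; apply/negP => qv.
have A0 : A !=set0.
  have [a a0 av] := normalize v v0.
  exists (0, a *: v); split; [split => //=|].
    by rewrite in_itv /= lexx ler01.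
  rewrite /q /= qformZ /N clE ?lexx ?ler01 //.
  by rewrite pmulr_rle0 // exprn_gt0.
have fstc : continuous (fst : R * 'rV[R]_n -> R) by move=> x; exact: cvg_fst.
have [[t w] /set_mem [[/= tI wS] qw] tmax] :=
  compact_EVT_max A0 Ac (continuous_subspaceT fstc).
have t01 : 0 <= t <= 1 by move: tI; rewrite in_itv.
have w0 : w != 0.
  apply/eqP => w0; move: wS; rewrite w0; under eq_bigr do rewrite mxE expr0n.
  by rewrite big1 // => /eqP; rewrite eq_sym oner_eq0.
rewrite /q /= /N clE // in qw.
have t1 : t < 1.
  rewrite lt_neqAle; case/andP: t01 => _ ->; rewrite andbT.
  by apply/eqP => t1; have := pd1 w w0; rewrite ltNge -t1 qw.
(* A negative value at time t would persist slightly later, still before 1, contradicting the choice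
   of t. *)
have psd u : 0 <= qform (M t) u.
  rewrite leNgt; apply/negP => qu.
  have u0 : u != 0 by apply: contraTneq qu => ->; rewrite /qform !mul0mx mxE ltxx.
  have [a a0 aS] := normalize u u0.
  have qau : q (t, a *: u) < 0.
    by rewrite /q /= /N clE // qformZ pmulr_rlt0 // exprn_gt0.
  have qtc : {for t, continuous (fun s : R => q (s, a *: u))}.
    apply: (@continuous_comp _ _ _ (fun s : R => (s, a *: u)) q); last exact: qc.
    apply: (@cvg_pair _ _ _ (nbhs t) (nbhs t) (nbhs (a *: u)) _ _ _ id (fun=> a *: u)); [exact: cvg_id|exact: cvg_cst].
  have near_t : \forall s \near t^'+, q (s, a *: u) < 0.
    have qtr := cvg_at_right_filter qtc.
    by apply: (cvgr_lt (q (t, a *: u)) qtr).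
  have [s [[qs ts] s1]] : exists s, (q (s, a *: u) < 0 /\ t < s) /\ s < 1.
    have : \forall s \near t^'+, (q (s, a *: u) < 0 /\ t < s) /\ s < 1.
      apply: filterI; last exact: nbhs_right_lt.
      by apply: filterI; [exact: near_t|exact: nbhs_right_gt].
    by move=> h; have [s hs] := @filter_ex _ _ (at_right_proper_filter t) _ h; exists s.
  have := tmax (s, a *: u); rewrite /= leNgt ts => h.
  suff : false by []; apply: h; apply/mem_set; split; last exact: ltW.
  split => //=; rewrite in_itv /= (ltW s1) andbT.
  by case/andP: t01 => t0 _; rewrite (le_trans t0) // ltW.
have qw0 : qform (M t) w = 0 by apply/eqP; rewrite eq_le qw psd.
by move/eqP: w0; apply; apply: (Mnd t t01); exact: psd_null_kernel.
Qed.

End QuadraticForms.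

(** * The symmetric 6 by 6 matrix and its transport *)

(** Every cofactor and minor is written in one fixed order of the corners, so that symmetry of the
    matrix is syntactic; [angmx_mul] pays by normalizing the permuted arguments in [angrow]. *)
Definition angtab (x12 x13 x14 x23 x24 x34 : R) : seq (seq R) :=
  let M1 := gminor x23 x24 x34 in let M2 := gminor x13 x14 x34 in
  let M3 := gminor x12 x14 x24 in let M4 := gminor x12 x13 x23 in
  let C12 := gcof x12 x13 x14 x23 x24 x34 in
  let C13 := gcof x13 x12 x14 x23 x34 x24 in
  let C14 := gcof x14 x12 x13 x24 x34 x23 in
  let C23 := gcof x23 x12 x24 x13 x34 x14 in
  let C24 := gcof x24 x12 x23 x14 x34 x13 in
  let C34 := gcof x34 x13 x23 x14 x24 x12 in
  [:: [:: kap x12 x13 x14 x23 x24 x34; C14 / M4; C13 / M3; C24 / M4; C23 / M3; 1];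
      [:: C14 / M4; kap x13 x12 x14 x23 x34 x24; C12 / M2; C34 / M4; 1; C23 / M2];
      [:: C13 / M3; C12 / M2; kap x14 x12 x13 x24 x34 x23; 1; C34 / M3; C24 / M2];
      [:: C24 / M4; C34 / M4; 1; kap x23 x12 x24 x13 x34 x14; C12 / M1; C13 / M1];
      [:: C23 / M3; 1; C34 / M3; C12 / M1; kap x24 x12 x23 x14 x34 x13; C14 / M1];
      [:: 1; C23 / M2; C24 / M2; C13 / M1; C14 / M1; kap x34 x13 x23 x14 x24 x12]].

Definition angmx x12 x13 x14 x23 x24 x34 : 'M[R]_6 :=
  (\matrix_(i < 6, j < 6) nth 0%R (nth [::] (angtab x12 x13 x14 x23 x24 x34) i) j)%R.

Definition rv6 (y12 y13 y14 y23 y24 y34 : R) : 'rV[R]_6 :=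
  (\row_(j < 6) nth 0%R [:: y12; y13; y14; y23; y24; y34] j)%R.

Lemma rv6_surj (v : 'rV[R]_6) : exists y12 y13 y14 y23 y24 y34,
  v = rv6 y12 y13 y14 y23 y24 y34.
Proof.
exists (v ord0 (inord 0)), (v ord0 (inord 1)), (v ord0 (inord 2)),
  (v ord0 (inord 3)), (v ord0 (inord 4)), (v ord0 (inord 5)).
apply/matrixP => i j; rewrite (ord1 i) mxE.
by case: j => [[|[|[|[|[|[|j]]]]]] lj] //=; congr (v _ _); apply/val_inj; rewrite /= inordK.
Qed.

Lemma angmx_sym x12 x13 x14 x23 x24 x34 :
  (angmx x12 x13 x14 x23 x24 x34)^T%R = angmx x12 x13 x14 x23 x24 x34.
Proof.
apply/matrixP => i j; rewrite !mxE.
by case: i => [[|[|[|[|[|[|i]]]]]] li]; case: j => [[|[|[|[|[|[|j]]]]]] lj].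
Qed.

Ltac gcof_to x h := repeat match goal with |- context [gcof x ?b ?c ?d ?e ?f] =>
    progress (replace (gcof x b c d e f) with h by (unfold gcof; ring)) end.
Ltac gminor_to h := repeat match goal with |- context [gminor ?a ?b ?c] =>
    progress (replace (gminor a b c) with h by (unfold gminor; ring)) end.

Lemma angmx_mul x12 x13 x14 x23 x24 x34 y12 y13 y14 y23 y24 y34 :
  (rv6 y12 y13 y14 y23 y24 y34 *m angmx x12 x13 x14 x23 x24 x34)%R =
  rv6 (angrow x12 x13 x14 x23 x24 x34 y12 y13 y14 y23 y24 y34)
      (angrow x13 x12 x14 x23 x34 x24 y13 y12 y14 y23 y34 y24)
      (angrow x14 x12 x13 x24 x34 x23 y14 y12 y13 y24 y34 y23)
      (angrow x23 x12 x24 x13 x34 x14 y23 y12 y24 y13 y34 y14)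
      (angrow x24 x12 x23 x14 x34 x13 y24 y12 y23 y14 y34 y13)
      (angrow x34 x13 x23 x14 x24 x12 y34 y13 y23 y14 y24 y12).
Proof.
apply/matrixP => i j; rewrite (ord1 i) !mxE !big_ord_recl big_ord0 !mxE /=.
rewrite -!RplusE -!RmultE -R0E.
case: j => [[|[|[|[|[|[|j]]]]]] lj] //=; rewrite /angrow.
all: gcof_to x12 (gcof x12 x13 x14 x23 x24 x34); gcof_to x13 (gcof x13 x12 x14 x23 x34 x24);
  gcof_to x14 (gcof x14 x12 x13 x24 x34 x23); gcof_to x23 (gcof x23 x12 x24 x13 x34 x14);
  gcof_to x24 (gcof x24 x12 x23 x14 x34 x13); gcof_to x34 (gcof x34 x13 x23 x14 x24 x12);
  gminor_to (gminor x23 x24 x34); gminor_to (gminor x13 x14 x34);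
  gminor_to (gminor x12 x14 x24); gminor_to (gminor x12 x13 x23).
all: ring.
Qed.

Lemma qform_angmx x12 x13 x14 x23 x24 x34 y12 y13 y14 y23 y24 y34 :
  qform (angmx x12 x13 x14 x23 x24 x34) (rv6 y12 y13 y14 y23 y24 y34) =
  angform x12 x13 x14 x23 x24 x34 y12 y13 y14 y23 y24 y34.
Proof.
rewrite /qform angmx_mul mxE !big_ord_recl big_ord0 !mxE /=.
rewrite -!RplusE -!RmultE -R0E /angform. ring.
Qed.

Lemma rv6_eq0 y12 y13 y14 y23 y24 y34 : rv6 y12 y13 y14 y23 y24 y34 = 0%R <->
  y12 = 0 /\ y13 = 0 /\ y14 = 0 /\ y23 = 0 /\ y24 = 0 /\ y34 = 0.
Proof.
split=> [/matrixP h|[-> [-> [-> [-> [-> ->]]]]]].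
  have e k : (k < 6)%N -> nth 0%R [:: y12; y13; y14; y23; y24; y34] k = 0.
    by move=> lk; have := h ord0 (Ordinal lk); rewrite !mxE.
  by repeat split; [exact: (e 0%N)|exact: (e 1%N)|exact: (e 2%N)|exact: (e 3%N)|exact: (e 4%N)|exact: (e 5%N)].
by apply/matrixP => i j; rewrite !mxE; case: j => [[|[|[|[|[|[|j]]]]]] lj].
Qed.

Lemma angform_posdefE x12 x13 x14 x23 x24 x34 :
  angform_posdef x12 x13 x14 x23 x24 x34 <-> posdef (angmx x12 x13 x14 x23 x24 x34).
Proof.
split=> [pf v|pd y12 y13 y14 y23 y24 y34].
  have [y12 [y13 [y14 [y23 [y24 [y34 ->]]]]]] := rv6_surj v.
  move=> /eqP v0; rewrite qform_angmx; apply/RltP/Rnot_le_lt => h.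
  by apply: v0; apply/rv6_eq0; exact: pf.
move=> h; apply/rv6_eq0; case: (rv6 y12 y13 y14 y23 y24 y34 =P 0%R) => // /eqP v0.
have := pd _ v0.
by rewrite qform_angmx => /RltP /Rlt_not_le.
Qed.

Ltac dcont :=
  match goal with
  | |- continuity_pt (fun x => @?f x + @?g x) _ => apply (continuity_pt_plus f g); dcont
  | |- continuity_pt (fun x => @?f x - @?g x) _ => apply (continuity_pt_minus f g); dcont
  | |- continuity_pt (fun x => @?f x * @?g x) _ => apply (continuity_pt_mult f g); dcont
  | |- continuity_pt (fun x => @?f x / @?g x) _ => apply (continuity_pt_div f g); [dcont|dcont|]
  | |- continuity_pt (fun x => x) _ => apply derivable_continuous_pt, derivable_pt_id
  | |- continuity_pt (fun x => ?c) _ => apply continuity_pt_const; intros ? ?; reflexivity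
  | |- _ => try assumption
  end.

Lemma gcof_cont p q r s t w x :
  continuity_pt p x -> continuity_pt q x -> continuity_pt r x ->
  continuity_pt s x -> continuity_pt t x -> continuity_pt w x ->
  continuity_pt (fun x => gcof (p x) (q x) (r x) (s x) (t x) (w x)) x.
Proof.
by move=> *; rewrite /gcof; dcont.
Qed.

Lemma gminor_cont p q s x :
  continuity_pt p x -> continuity_pt q x -> continuity_pt s x ->
  continuity_pt (fun x => gminor (p x) (q x) (s x)) x.
Proof. by move=> *; rewrite /gminor; dcont. Qed.

Lemma gdet_cont p q r s t w x :
  continuity_pt p x -> continuity_pt q x -> continuity_pt r x ->
  continuity_pt s x -> continuity_pt t x -> continuity_pt w x ->
  continuity_pt (fun x => gdet (p x) (q x) (r x) (s x) (t x) (w x)) x.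
Proof. by move=> *; rewrite /gdet; dcont. Qed.

Lemma gcof_div_cont p q r s t w a b c x :
  continuity_pt p x -> continuity_pt q x -> continuity_pt r x ->
  continuity_pt s x -> continuity_pt t x -> continuity_pt w x ->
  continuity_pt a x -> continuity_pt b x -> continuity_pt c x ->
  1 < a x -> 1 < b x -> 1 < c x ->
  continuity_pt (fun x => gcof (p x) (q x) (r x) (s x) (t x) (w x) / gminor (a x) (b x) (c x)) x.
Proof.
move=> *.
apply: (continuity_pt_div (fun x => gcof (p x) (q x) (r x) (s x) (t x) (w x)) (fun x => gminor (a x) (b x) (c x))).
- exact: gcof_cont.
- exact: gminor_cont.
- by apply: Rlt_not_eq; exact: gminor_neg.
Qed.

Lemma kap_cont p q r s t w x :
  continuity_pt p x -> continuity_pt q x -> continuity_pt r x ->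
  continuity_pt s x -> continuity_pt t x -> continuity_pt w x ->
  1 < p x -> 1 < q x -> 1 < r x -> 1 < s x -> 1 < t x -> 1 < w x ->
  gdet (p x) (q x) (r x) (s x) (t x) (w x) < 0 ->
  continuity_pt (fun x => kap (p x) (q x) (r x) (s x) (t x) (w x)) x.
Proof.
move=> cp cq cr cs ct cw hp hq hr hs ht hw hD; rewrite /kap.
dcont; try exact: gcof_cont; try exact: gminor_cont; try exact: gdet_cont;
  try (by apply: Rlt_not_eq; exact: gminor_neg).
apply: Rmult_integral_contrapositive_currified; first exact: Rlt_not_eq.
by apply: Rlt_not_eq; nra.
Qed.

Lemma angform_posdef_transport (x12 x13 x14 x23 x24 x34 : R -> R) :
  (forall t, 0 <= t <= 1 ->
    (continuity_pt x12 t /\ continuity_pt x13 t /\ continuity_pt x14 t /\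
     continuity_pt x23 t /\ continuity_pt x24 t /\ continuity_pt x34 t) /\
    hyper_gram (x12 t) (x13 t) (x14 t) (x23 t) (x24 t) (x34 t)) ->
  angform_posdef (x12 1) (x13 1) (x14 1) (x23 1) (x24 1) (x34 1) ->
  angform_posdef (x12 0) (x13 0) (x14 0) (x23 0) (x24 0) (x34 0).
Proof.
move=> H /angform_posdefE pd1; apply/angform_posdefE.
apply: (@posdef_transport R 6
  (fun t => angmx (x12 t) (x13 t) (x14 t) (x23 t) (x24 t) (x34 t)));
  [by move=> t; exact: angmx_sym| | |exact: pd1].
- move=> t /andP[/RleP t0 /RleP t1] i j.
  have [[c12 [c13 [c14 [c23 [c24 c34]]]]] [[h12 [h13 [h14 [h23 [h24 h34]]]]] hD]] := H t (conj t0 t1).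
  have [g2 [g3 [g4 [g5 g6]]]] := gdet_views (x12 t) (x13 t) (x14 t) (x23 t) (x24 t) (x34 t).
  rewrite (_ : (fun t => _) = (fun t =>
    nth 0%R (nth [::] (angtab (x12 t) (x13 t) (x14 t) (x23 t) (x24 t) (x34 t)) i) j));
    last by apply: boolp.funext => u; rewrite mxE.
  apply/continuity_ptE.
  case: i => [[|[|[|[|[|[|i]]]]]] li] //; case: j => [[|[|[|[|[|[|j]]]]]] lj] //=;
    first [exact: gcof_div_cont | by apply: kap_cont => //; rewrite ?g2 ?g3 ?g4 ?g5 ?g6 |
           by apply: continuity_pt_const => ? ?].
- move=> t /andP[/RleP t0 /RleP t1] v.
  have [_ [[h12 [h13 [h14 [h23 [h24 h34]]]]] hD]] := H t (conj t0 t1).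
  have [y12 [y13 [y14 [y23 [y24 [y34 ->]]]]]] := rv6_surj v.
  rewrite angmx_mul => /rv6_eq0 [e12 [e13 [e14 [e23 [e24 e34]]]]]; apply/rv6_eq0.
  exact: (angrow_nondeg _ _ _ _ _ _ _ _ _ _ _ _ h12 h13 h14 h23 h24 h34 hD e12 e13 e14 e23 e24 e34).
Qed.

(** * Local strict monotonicity for a packed tetrahedron *)

Lemma cosh_lt x y : 0 <= x -> x < y -> cosh x < cosh y.
Proof.
move=> x0 xy; have cx := cosh2_sinh2 x; have cy := cosh2_sinh2 y.
have px := cosh_pos x; have py := cosh_pos y.
have s := sinh_lt _ _ xy.
have s0 : 0 <= sinh x by case: x0 => [/sinh_pos|<-]; rewrite ?sinh_0; lra.
nra.
Qed.

Lemma cosh_acosh x : 1 <= x -> cosh (acosh x) = x.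
Proof.
move=> x1; have q := sqrt_def (x * x - 1) ltac:(nra); have q0 := sqrt_pos (x * x - 1).
rewrite /cosh /acosh exp_Ropp exp_ln; last lra.
by apply: (Rmult_eq_reg_r (x + sqrt (x * x - 1))); [field_simplify; nra|lra].
Qed.

Lemma acosh_pos x : 1 < x -> 0 < acosh x.
Proof.
move=> x1; rewrite /acosh -ln_1; apply: ln_increasing; first lra.
have q0 := sqrt_pos (x * x - 1); lra.
Qed.

Lemma acosh_inj x y : 1 <= x -> 1 <= y -> acosh x = acosh y -> x = y.
Proof. by move=> x1 y1 e; rewrite -(cosh_acosh x1) -(cosh_acosh y1) e. Qed.

(** * Neighbourhoods in edge and radius coordinates *)

(* Only the first six entries of a sequence are meant: they index edges or corners. *)
Definition cont_at (x0 : nat -> R) (f : (nat -> R) -> R) :=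
  forall eta, 0 < eta -> exists eps, 0 < eps /\
    forall x, (forall k, (k < 6)%N -> Rabs (x k - x0 k) < eps) -> Rabs (f x - f x0) < eta.

Section ContAt.
Variable x0 : nat -> R.

Lemma cont_at_comp g k : (k < 6)%N -> continuity_pt g (x0 k) -> cont_at x0 (fun x => g (x k)).
Proof.
move=> k6 gc eta eta0; have [a [a0 ha]] := gc eta eta0.
exists a; split=> // x hx.
case: (Req_dec (x k) (x0 k)) => [->|ne]; first by rewrite Rminus_diag Rabs_R0.
by apply: ha; split; [split=> //; exact/not_eq_sym|exact: hx].
Qed.

Lemma cont_at_cst c : cont_at x0 (fun=> c).
Proof. by move=> eta eta0; exists 1; split=> [|x _]; [lra|rewrite Rminus_diag Rabs_R0]. Qed.

Lemma cont_at_plus f g : cont_at x0 f -> cont_at x0 g -> cont_at x0 (fun x => f x + g x).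
Proof.
move=> cf cg eta eta0.
have [a [a0 ha]] := cf (eta / 2) ltac:(lra); have [b [b0 hb]] := cg (eta / 2) ltac:(lra).
exists (Rmin a b); split=> [|x hx]; first exact: Rmin_pos.
have fa : Rabs (f x - f x0) < eta / 2 by apply: ha => k k6; apply: Rlt_le_trans (hx k k6) (Rmin_l _ _).
have gb : Rabs (g x - g x0) < eta / 2 by apply: hb => k k6; apply: Rlt_le_trans (hx k k6) (Rmin_r _ _).
move: fa gb => /Rabs_def2 fa /Rabs_def2 gb; apply: Rabs_def1; lra.
Qed.

Lemma cont_at_mult f g : cont_at x0 f -> cont_at x0 g -> cont_at x0 (fun x => f x * g x).
Proof.
move=> cf cg eta eta0.
have u0 := Rabs_pos (f x0); have v0 := Rabs_pos (g x0).
set m := Rmin 1 (eta / (Rabs (f x0) + Rabs (g x0) + 2)).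
have m0 : 0 < m by apply: Rmin_pos; [lra|apply: Rdiv_lt_0_compat; lra].
have m1 : m <= 1 := Rmin_l _ _.
have m2 : m * (Rabs (f x0) + Rabs (g x0) + 2) <= eta.
  have := Rmin_r 1 (eta / (Rabs (f x0) + Rabs (g x0) + 2)); rewrite -/m => h.
  apply: (Rle_trans _ (eta / (Rabs (f x0) + Rabs (g x0) + 2) * (Rabs (f x0) + Rabs (g x0) + 2))).
    by apply: Rmult_le_compat_r => //; lra.
  by right; field; lra.
have [a [a0 ha]] := cf m m0; have [b [b0 hb]] := cg m m0.
exists (Rmin a b); split=> [|x hx]; first exact: Rmin_pos.
have fa : Rabs (f x - f x0) < m by apply: ha => k k6; apply: Rlt_le_trans (hx k k6) (Rmin_l _ _).
have gb : Rabs (g x - g x0) < m by apply: hb => k k6; apply: Rlt_le_trans (hx k k6) (Rmin_r _ _).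
have -> : f x * g x - f x0 * g x0 =
  (f x - f x0) * (g x - g x0) + (f x - f x0) * g x0 + f x0 * (g x - g x0) by ring.
apply: Rle_lt_trans (Rabs_triang _ _) _.
have := Rabs_triang ((f x - f x0) * (g x - g x0)) ((f x - f x0) * g x0).
rewrite !Rabs_mult => h.
have := Rabs_pos (f x - f x0); have := Rabs_pos (g x - g x0) => p1 p2.
nra.
Qed.

Lemma cont_at_minus f g : cont_at x0 f -> cont_at x0 g -> cont_at x0 (fun x => f x - g x).
Proof.
move=> cf cg eta eta0.
have [a [a0 ha]] := cf (eta / 2) ltac:(lra); have [b [b0 hb]] := cg (eta / 2) ltac:(lra).
exists (Rmin a b); split=> [|x hx]; first exact: Rmin_pos.
have fa : Rabs (f x - f x0) < eta / 2 by apply: ha => k k6; apply: Rlt_le_trans (hx k k6) (Rmin_l _ _).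
have gb : Rabs (g x - g x0) < eta / 2 by apply: hb => k k6; apply: Rlt_le_trans (hx k k6) (Rmin_r _ _).
move: fa gb => /Rabs_def2 fa /Rabs_def2 gb; apply: Rabs_def1; lra.
Qed.

End ContAt.

Ltac cont_at_tac x0 :=
  match goal with
  | |- cont_at _ (fun x => @?f x + @?g x) => apply (@cont_at_plus x0 f g); cont_at_tac x0
  | |- cont_at _ (fun x => @?f x - @?g x) => apply (@cont_at_minus x0 f g); cont_at_tac x0
  | |- cont_at _ (fun x => @?f x * @?g x) => apply (@cont_at_mult x0 f g); cont_at_tac x0
  | |- cont_at _ (fun x => x ?k) => apply (@cont_at_comp x0 id k isT); apply derivable_continuous_pt, derivable_pt_id
  | |- cont_at _ (fun x => ?c) => apply cont_at_cst
  | |- _ => idtac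
  end.

Lemma gdet_cont_at x0 : cont_at x0 (fun x => gdet (x 0%N) (x 1%N) (x 2%N) (x 3%N) (x 4%N) (x 5%N)).
Proof. by rewrite /gdet; cont_at_tac x0. Qed.

Definition hyper_seq (x : nat -> R) := hyper_gram (x 0%N) (x 1%N) (x 2%N) (x 3%N) (x 4%N) (x 5%N).
Definition posdef_seq (x : nat -> R) := angform_posdef (x 0%N) (x 1%N) (x 2%N) (x 3%N) (x 4%N) (x 5%N).

Lemma cont_at_lt x0 f b : cont_at x0 f -> f x0 < b ->
  exists eps, 0 < eps /\ forall x, (forall k, (k < 6)%N -> Rabs (x k - x0 k) < eps) -> f x < b.
Proof.
move=> cf fb; have [e [e0 he]] := cf (b - f x0) ltac:(lra).
by exists e; split=> // x /he /Rabs_def2; lra.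
Qed.

Lemma hyper_seq_open x0 : hyper_seq x0 ->
  exists eps, 0 < eps /\ forall x, (forall k, (k < 6)%N -> Rabs (x k - x0 k) < eps) -> hyper_seq x.
Proof.
move=> [[h0 [h1 [h2 [h3 [h4 h5]]]]] hD].
have [e [e0 he]] := cont_at_lt (gdet_cont_at x0) hD.
have mins a b : 0 < a -> 0 < b -> exists m, [/\ 0 < m, m <= a & m <= b].
  by exists (Rmin a b); split; [exact: Rmin_pos|exact: Rmin_l|exact: Rmin_r].
have [m0 [m00 n0 n1]] := mins (x0 0%N - 1) (x0 1%N - 1) ltac:(lra) ltac:(lra).
have [m1 [m10 n2 n3]] := mins (x0 2%N - 1) (x0 3%N - 1) ltac:(lra) ltac:(lra).
have [m2 [m20 n4 n5]] := mins (x0 4%N - 1) (x0 5%N - 1) ltac:(lra) ltac:(lra).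
have [m3 [m30 n6 n7]] := mins m0 m1 m00 m10.
have [m4 [m40 n8 n9]] := mins m2 m3 m20 m30.
have [m [m_gt0 me m4m]] := mins e m4 e0 m40.
exists m; split=> //.
move=> x hx; split; last first.
  by apply: he => k k6; apply: Rlt_le_trans (hx k k6) me.
have B k : (k < 6)%N -> m <= x0 k - 1 -> 1 < x k by move=> k6 mb; move: (hx k k6) => /Rabs_def2; lra.
by repeat split; apply: B => //; lra.
Qed.

Lemma posdef_seq_transport (x : R -> nat -> R) :
  (forall t, 0 <= t <= 1 -> (forall k, continuity_pt (fun t => x t k) t) /\ hyper_seq (x t)) ->
  posdef_seq (x 1) -> posdef_seq (x 0).
Proof.
move=> H; apply: (@angform_posdef_transport (fun t => x t 0%N) (fun t => x t 1%N) (fun t => x t 2%N)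
  (fun t => x t 3%N) (fun t => x t 4%N) (fun t => x t 5%N)) => t /H [c h].
by split=> //; repeat split; apply: c.
Qed.

(** Boxes are convex, so the definiteness known at the centre is transported along the segment to
    any other point. *)
Lemma posdef_seq_box x0 eps :
  (forall x, (forall k, (k < 6)%N -> Rabs (x k - x0 k) < eps) -> hyper_seq x) -> posdef_seq x0 ->
  forall x, (forall k, (k < 6)%N -> Rabs (x k - x0 k) < eps) -> posdef_seq x.
Proof.
move=> box p0 x hx.
have e0 : (fun k => x k + 0 * (x0 k - x k)) = x by apply: boolp.funext => k; ring.
have e1 : (fun k => x k + 1 * (x0 k - x k)) = x0 by apply: boolp.funext => k; ring.
rewrite -e0; apply: (@posdef_seq_transport (fun t k => x k + t * (x0 k - x k))); last by rewrite e1.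
move=> t t01; split.
  by move=> k; dcont.
apply: box => k k6; have -> : x k + t * (x0 k - x k) - x0 k = (1 - t) * (x k - x0 k) by ring.
rewrite Rabs_mult (Rabs_right (1 - t)); last lra.
by have := Rabs_pos (x k - x0 k); have := hx k k6; nra.
Qed.

(* The edges are numbered in the order 12, 13, 14, 23, 24, 34. *)
Definition edge_head (k : nat) : nat := nth 2%N [:: 0; 0; 0; 1; 1; 2]%N k.
Definition edge_tail (k : nat) : nat := nth 3%N [:: 1; 2; 3; 2; 3; 3]%N k.

Definition packn (c : nat -> R) (r : nat -> R) (k : nat) : R :=
  packed (sinh (r (edge_head k))) (cosh (r (edge_head k)))
    (sinh (r (edge_tail k))) (cosh (r (edge_tail k))) (c k).

Lemma packn_cont (c r : R -> nat -> R) k t :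
  (forall k, continuity_pt (fun t => c t k) t) -> (forall a, continuity_pt (fun t => r t a) t) ->
  continuity_pt (fun t => packn (c t) (r t) k) t.
Proof.
move=> cc rc; rewrite /packn /packed.
have sc a : continuity_pt (fun t => sinh (r t a)) t.
  apply: (continuity_pt_comp (fun t => r t a) sinh) => //.
  by apply: derivable_continuous_pt; exact: derivable_pt_sinh.
have ch a : continuity_pt (fun t => cosh (r t a)) t.
  apply: (continuity_pt_comp (fun t => r t a) cosh) => //.
  by apply: derivable_continuous_pt; exact: derivable_pt_cosh.
dcont; done.
Qed.

(** For packings with these weights the determinant condition is automatic, so a path only has to
    keep the six edge values above 1. *)
Lemma hyper_seq_packn c r :
  (forall a, 0 < r a) -> (forall k, third (c k)) ->
  (forall k, (k < 6)%N -> 1 < packn c r k) -> hyper_seq (packn c r).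
Proof.
move=> r0 c3 x1; split; first by repeat split; apply: x1.
by apply: gdet_packed_neg; try apply: c3; try apply: sinh_pos; try apply: cosh_pos;
  try apply: cosh2_sinh2; apply: r0.
Qed.

Lemma packn_le c r c' r' k : (forall a, 0 < r a <= r' a) -> 0 <= c k <= c' k ->
  packn c r k <= packn c' r' k.
Proof.
move=> hr hc; rewrite /packn /packed.
have S a : 0 < sinh (r a) <= sinh (r' a).
  have [r0 [lt|<-]] := hr a; split; try exact: sinh_pos; last lra.
  exact/Rlt_le/sinh_lt.
have C a : 0 < cosh (r a) <= cosh (r' a).
  have [r0 [lt|<-]] := hr a; split; try exact: cosh_pos; last lra.
  by apply/Rlt_le/cosh_lt => //; lra.
have := S (edge_head k); have := S (edge_tail k); have := C (edge_head k); have := C (edge_tail k).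
move: (sinh _) (sinh _) (sinh _) (sinh _) (cosh _) (cosh _) (cosh _) (cosh _).
move=> s1 s2 s3 s4 c1 c2 c3 c4 h1 h2 h3 h4.
apply: Rplus_le_compat; first by apply: Rmult_le_compat; lra.
have ? : 0 <= c k * c2 by apply: Rmult_le_pos; lra.
by apply: Rmult_le_compat; try lra; apply: Rmult_le_compat; lra.
Qed.

Lemma posdef_seq_packn c r B :
  (forall a, 0 < r a <= B) -> (forall k, third (c k)) ->
  (forall k, (k < 6)%N -> 1 < packn c r k) -> posdef_seq (packn c r).
Proof.
move=> rB c3 x1.
pose ct (t : R) k := c k + t * (1 - c k); pose rt (t : R) a := r a + t * (B - r a).
have c0 : ct 0 = c by apply: boolp.funext => k; rewrite /ct; ring.
have r0 : rt 0 = r by apply: boolp.funext => k; rewrite /rt; ring.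
rewrite -c0 -r0; apply: (@posdef_seq_transport (fun t => packn (ct t) (rt t))).
  move=> t t01; split.
    by move=> k; apply: packn_cont => ?; rewrite /ct /rt; dcont.
  have rt_ge a : 0 < r a <= rt t a.
    have := rB a => -[ra0 ra]; split=> //; rewrite /rt.
    have : 0 <= t * (B - r a) by apply: Rmult_le_pos; lra.
    by lra.
  have ct3 k : c k <= ct t k /\ third (ct t k).
    have [h1 h2] := c3 k; rewrite /third /ct.
    have : 0 <= t * (1 - c k) by apply: Rmult_le_pos; lra.
    have : 0 <= (1 - t) * (1 - c k) by apply: Rmult_le_pos; lra.
    by lra.
  apply: hyper_seq_packn => [a|k|k k6]; first by have := rt_ge a; lra.
    by have [] := ct3 k.
  apply: Rlt_le_trans (x1 k k6) _; apply: packn_le => //.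
  by have [h _] := c3 k; have [h' _] := ct3 k; lra.
have B0 : 0 < B by have := rB 0%N; lra.
(* Weights with cosine 1 and equal radii B: a regular tetrahedron with edge length 2 B. *)
have -> : packn (ct 1) (rt 1) = fun=> sinh B * sinh B + cosh B * cosh B.
  apply: boolp.funext => k; rewrite /packn /packed /rt /ct.
  by rewrite !(_ : forall a, r a + 1 * (B - r a) = B); [ring|move=> a; ring..].
move=> y12 y13 y14 y23 y24 y34 h.
have X1 : 1 < sinh B * sinh B + cosh B * cosh B.
  by have := cosh2_sinh2 B; have := sinh_pos B B0; nra.
have [p z] := angform_regular _ y12 y13 y14 y23 y24 y34 X1.
by apply: z; apply: Rle_antisym.
Qed.

Lemma near_all n (P : nat -> R -> Prop) :
  (forall k e e', (k < n)%N -> e' <= e -> P k e -> P k e') ->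
  (forall k, (k < n)%N -> exists e, 0 < e /\ P k e) ->
  exists e, 0 < e /\ forall k, (k < n)%N -> P k e.
Proof.
elim: n => [|n IH] mono H; first by exists 1; split=> //; lra.
have [e [e0 he]] := IH (fun k a b kn => mono k a b (ltnW kn)) (fun k kn => H k (ltnW kn)).
have [f [f0 hf]] := H n (ltnSn n).
exists (Rmin e f); split; first exact: Rmin_pos.
move=> k; rewrite ltnS leq_eqVlt => /orP[/eqP ->|kn].
  by apply: mono (ltnSn n) (Rmin_r _ _) hf.
by apply: mono (ltnW _) (Rmin_l _ _) (he k kn); rewrite ltnS.
Qed.

Definition pairingn (x d : nat -> R) : R :=
  angle_pairing (x 0%N) (x 1%N) (x 2%N) (x 3%N) (x 4%N) (x 5%N)
    (d 0%N) (d 1%N) (d 2%N) (d 3%N) (d 4%N) (d 5%N).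

Lemma pairing_rigid x0 : hyper_seq x0 -> posdef_seq x0 ->
  exists eps, 0 < eps /\ forall x, (forall k, (k < 6)%N -> Rabs (x k - x0 k) < eps) ->
    pairingn x (fun k => acosh (x k) - acosh (x0 k)) <=
    pairingn x0 (fun k => acosh (x k) - acosh (x0 k)) ->
    forall k, (k < 6)%N -> acosh (x k) = acosh (x0 k).
Proof.
move=> h0 p0; have [e [e0 he]] := hyper_seq_open h0; exists e; split=> // x hx.
set d := fun k => acosh (x k) - acosh (x0 k) => hle.
have g1 y : hyper_seq y -> forall k, (k < 6)%N -> 1 < y k.
  by move=> [[? [? [? [? [? ?]]]]] _] [|[|[|[|[|[|k]]]]]].
have x1 := g1 x (he x hx); have x01 := g1 x0 h0.
have lpos s k : 0 <= s <= 1 -> (k < 6)%N -> 0 < acosh (x0 k) + s * d k.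
  move=> s01 k6; have a0 := acosh_pos (x1 k k6); have a1 := acosh_pos (x01 k k6).
  by rewrite /d; nra.
(* The segment is straight in the lengths while the box is in their cosh. As cosh is increasing,
   each coordinate stays between its two end values, hence in the box. *)
have lbox s : 0 <= s <= 1 ->
    forall k, (k < 6)%N -> Rabs (cosh (acosh (x0 k) + s * d k) - x0 k) < e.
  move=> s01 k k6; have := hx k k6.
  have cle a b : 0 <= a -> a <= b -> cosh a <= cosh b.
    by move=> a0 [/(cosh_lt a0)|->]; lra.
  have a0 := acosh_pos (x1 k k6); have a1 := acosh_pos (x01 k k6); have l0 := lpos s k s01 k6.
  have c1 := cosh_acosh (Rlt_le _ _ (x1 k k6)); have c0 := cosh_acosh (Rlt_le _ _ (x01 k k6)).
  case: (Rle_dec 0 (d k)) => dk.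
    have : cosh (acosh (x0 k)) <= cosh (acosh (x0 k) + s * d k) by apply: cle; [lra|nra].
    have : cosh (acosh (x0 k) + s * d k) <= cosh (acosh (x k)).
      by apply: cle; [lra|rewrite /d in dk *; nra].
    by move=> ? ? /Rabs_def2 ?; apply: Rabs_def1; lra.
  have : cosh (acosh (x0 k) + s * d k) <= cosh (acosh (x0 k)) by apply: cle; [lra|nra].
  have : cosh (acosh (x k)) <= cosh (acosh (x0 k) + s * d k).
    by apply: cle; [lra|rewrite /d in dk *; nra].
  by move=> ? ? /Rabs_def2 ?; apply: Rabs_def1; lra.
have [] := @angle_pairing_pos (acosh (x0 0%N)) (acosh (x0 1%N)) (acosh (x0 2%N)) (acosh (x0 3%N))
  (acosh (x0 4%N)) (acosh (x0 5%N)) (d 0%N) (d 1%N) (d 2%N) (d 3%N) (d 4%N) (d 5%N).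
- by move=> s s01; repeat split; apply: lpos.
- by move=> s s01; have [] := he _ (lbox s s01).
- by move=> s s01; exact: (posdef_seq_box he p0 (lbox s s01)).
- have e1 k : (k < 6)%N -> cosh (acosh (x0 k) + d k) = x k.
    move=> k6; rewrite /d Rplus_minus; exact/cosh_acosh/Rlt_le/x1.
  by rewrite !e1 // !cosh_acosh //; apply: Rlt_le; apply: x01.
- move=> z0 [z1 [z2 [z3 [z4 z5]]]] k k6; apply: Rminus_diag_uniq; rewrite -/(d k).
  by case: k k6 => [|[|[|[|[|[|k]]]]]].
Qed.

Lemma tet_rigid c r0 B :
  (forall a, 0 < r0 a <= B) -> (forall k, third (c k)) ->
  (forall k, (k < 6)%N -> 1 < packn c r0 k) ->
  exists eps, 0 < eps /\ forall r, (forall a, (a < 6)%N -> Rabs (r a - r0 a) < eps) ->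
    let d k := acosh (packn c r k) - acosh (packn c r0 k) in
    pairingn (packn c r) d <= pairingn (packn c r0) d -> forall k, (k < 6)%N -> d k = 0.
Proof.
move=> rB c3 x1; have r_gt0 a : 0 < r0 a by have := rB a; lra.
have [e [e0 he]] := pairing_rigid (hyper_seq_packn r_gt0 c3 x1) (posdef_seq_packn rB c3 x1).
have [f [f0 hf]] : exists f, 0 < f /\ forall k, (k < 6)%N ->
    forall r, (forall a, (a < 6)%N -> Rabs (r a - r0 a) < f) ->
      Rabs (packn c r k - packn c r0 k) < e.
  apply: near_all => [k a b _ ba h r hr|k k6].
    by apply: h => i i6; apply: Rlt_le_trans (hr i i6) ba.
  have [hk tk] : (edge_head k < 6)%N /\ (edge_tail k < 6)%N.
    by case: k k6 => [|[|[|[|[|[|k]]]]]].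
  have : cont_at r0 (fun r => packn c r k).
    rewrite /packn /packed; cont_at_tac r0; apply: cont_at_comp => //;
      apply: derivable_continuous_pt; first [exact: derivable_pt_sinh|exact: derivable_pt_cosh].
  by move=> /(_ e e0).
exists f; split=> // r hr d hle k k6; apply: Rminus_diag_eq.
by apply: he => // i i6; apply: hf.
Qed.

(** * The dihedral angles in terms of the Gram matrix *)

Import GRing.Theory.

Definition gram (x : nat -> R) : 'M[R]_4 := (\matrix_(i < 4, j < 4)
  nth 0%R (nth [::]
  [:: [:: 1; - x 0%N; - x 1%N; - x 2%N]; [:: - x 0%N; 1; - x 3%N; - x 4%N];
      [:: - x 1%N; - x 3%N; 1; - x 5%N]; [:: - x 2%N; - x 4%N; - x 5%N; 1]] i) j)%R.

Definition detn (x : nat -> R) : R := gdet (x 0%N) (x 1%N) (x 2%N) (x 3%N) (x 4%N) (x 5%N).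

Definition gadj (x : nat -> R) : 'M[R]_4 :=
  let x12 := x 0%N in let x13 := x 1%N in let x14 := x 2%N in
  let x23 := x 3%N in let x24 := x 4%N in let x34 := x 5%N in
  let C12 := gcof x12 x13 x14 x23 x24 x34 in
  let C13 := gcof x13 x12 x14 x23 x34 x24 in
  let C14 := gcof x14 x12 x13 x24 x34 x23 in
  let C23 := gcof x23 x12 x24 x13 x34 x14 in
  let C24 := gcof x24 x12 x23 x14 x34 x13 in
  let C34 := gcof x34 x13 x23 x14 x24 x12 in
  (\matrix_(i < 4, j < 4) nth 0%R (nth [::]
  [:: [:: gminor x23 x24 x34; C12; C13; C14]; [:: C12; gminor x13 x14 x34; C23; C24];
      [:: C13; C23; gminor x12 x14 x24; C34]; [:: C14; C24; C34; gminor x12 x13 x23]] i) j)%R.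

Lemma gadj_sym x : (gadj x)^T%R = gadj x.
Proof.
apply/matrixP => i j; rewrite !mxE.
by case: i => [[|[|[|[|i]]]] li]; case: j => [[|[|[|[|j]]]] lj].
Qed.

(** Certifies that the polynomials [gminor] and [gcof] are the cofactors of G. *)
Lemma mul_gram_gadj x : (gram x *m gadj x)%R = ((detn x)%:M)%R.
Proof.
apply/matrixP => i j; rewrite !mxE !big_ord_recl big_ord0 !mxE /=.
rewrite -!RplusE -!RmultE -R0E /detn.
by case: i => [[|[|[|[|i]]]] li]; case: j => [[|[|[|[|j]]]] lj] //=;
  rewrite /eqE /= ?mulr0n ?mulr1n -?R0E -?R1E -?RoppE /gdet /gcof /gminor; ring.
Qed.

Lemma det_gram x : (\det (gram x))%R = detn x.
Proof.
rewrite (expand_det_row _ ord0) !big_ord_recl big_ord0 /cofactor.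
rewrite !(expand_det_row _ ord0) !big_ord_recl !big_ord0 /cofactor.
rewrite !(expand_det_row _ ord0) !big_ord_recl !big_ord0 /cofactor !det_mx11.
rewrite !mxE /= -!RpowE -!RplusE -!RmultE -!RoppE -!R1E -!R0E /detn /gdet /bump /=.
ring.
Qed.

Definition corner (i : nat) : 'I_4 := inord i.

Definition edge_mink (v : 'I_4 -> vec4) (k : nat) : R :=
  - mink (v (corner (edge_head k))) (v (corner (edge_tail k))).

Lemma sumIE n (f : 'I_n -> R) : sumI f = (\sum_i f i)%R.
Proof. by rewrite /sumI foldrE big_map big_enum. Qed.

Definition signature : 'M[R]_4 := (diag_mx (\row_i (if i == ord0 then -1 else 1)))%R.
Definition vmx (v : 'I_4 -> vec4) : 'M[R]_4 := (\matrix_(a, k) v a k)%R.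

Lemma mink_mx v w a b :
  mink (v a) (w b) = ((vmx v *m signature *m (vmx w)^T) a b)%R.
Proof.
rewrite /mink sumIE /signature mul_mx_diag mxE [in RHS](bigD1 ord0) //= [in LHS](bigD1 ord0) //=.
rewrite !mxE eqxx mulrN1 mulNr add0r; congr (_ + _)%R.
by apply: eq_bigr => k k0; rewrite !mxE (negbTE k0) mulr1.
Qed.

Lemma mink_sym x y : mink x y = mink y x.
Proof.
rewrite /mink !sumIE (Rmult_comm (x ord0)).
apply: (f_equal2 Rplus erefl); apply: eq_bigr => k _.
by case: ifP => // _; rewrite Rmult_comm.
Qed.

Lemma gram_mink v : (forall c, mink (v c) (v c) = 1) ->
  (vmx v *m signature *m (vmx v)^T)%R = gram (edge_mink v).
Proof.
move=> h1; apply/matrixP => i j; rewrite -mink_mx mxE /edge_mink.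
have E k (lk : (k < 4)%N) : Ordinal lk = corner k by apply: val_inj; rewrite /= inordK.
case: i => [[|[|[|[|i]]]] li] //; case: j => [[|[|[|[|j]]]] lj] //=;
  rewrite !E ?h1 -?RoppE ?Ropp_involutive // mink_sym //.
Qed.

Lemma vmx_unit v : hyperideal_tet v -> (vmx v \in unitmx)%R.
Proof.
move=> [_ [free _]]; rewrite -row_free_unit; apply: inj_row_free => u u0.
apply/matrixP => i c; rewrite (ord1 i) [RHS]mxE; apply: (free (fun c => u ord0 c)) => k.
have /matrixP/(_ ord0 k) := u0; rewrite !mxE sumIE => e; apply: etrans e.
by apply: eq_bigr => j _; rewrite mxE.
Qed.

(** G = V S V^T with S the Lorentz signature and V invertible, so det G = - (det V)^2. *)
Lemma hyper_seq_mink v : hyperideal_tet v -> hyper_seq (edge_mink v).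
Proof.
move=> hv; have [h1 [_ hneg]] := hv.
have x1 k : (k < 6)%N -> 1 < edge_mink v k.
  move=> k6; suff : mink (v (corner (edge_head k))) (v (corner (edge_tail k))) < -1.
    by rewrite /edge_mink; lra.
  apply: hneg; apply/eqP => /(congr1 val).
  by case: k k6 => [|[|[|[|[|[|k]]]]]] //= _; rewrite !inordK.
split; first by repeat split; apply: x1.
have := det_gram (edge_mink v); rewrite -gram_mink // !det_mulmx det_tr det_diag.
rewrite !big_ord_recl big_ord0 !mxE /= /detn => <-.
have := vmx_unit hv; rewrite unitmxE GRing.unitfE => /eqP d0.
rewrite -!RmultE -R1E -RoppE. set d := (\det _)%R in d0 *.
have := Rsqr_pos_lt d d0; rewrite /Rsqr; lra.
Qed.

Lemma gadj_diag_neg x c : hyper_seq x -> gadj x c c < 0.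
Proof.
move=> [[? [? [? [? [? ?]]]]] _]; rewrite mxE.
by case: c => [[|[|[|[|c]]]] lc] //=; exact: gminor_neg.
Qed.

Lemma mul_gadj_gram x : (gadj x *m gram x)%R = ((detn x)%:M)%R.
Proof.
have gram_sym : (gram x)^T%R = gram x.
  apply/matrixP => i j; rewrite !mxE.
  by case: i => [[|[|[|[|i]]]] li]; case: j => [[|[|[|[|j]]]] lj].
by rewrite -gadj_sym -[gram x]gram_sym -trmx_mul mul_gram_gadj tr_scalar_mx.
Qed.

(* Row [c] of [N] is the multiple of the dual vector of [v c] by
   [f c = mink (n c) (v c)]; hence [N] has Gram matrix [F G^-1 F]. *)
Lemma normals_mink v n c d : hyperideal_tet v ->
  (forall h c, c != h -> mink (n h) (v c) = 0) ->
  detn (edge_mink v) * mink (n c) (n d) =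
  mink (n c) (v c) * gadj (edge_mink v) c d * mink (n d) (v d).
Proof.
move=> hv hn; have [h1 _] := hv; have VU := vmx_unit hv.
set x := edge_mink v; set A := gadj x.
pose F : 'M[R]_4 := (diag_mx (\row_i mink (n i) (v i)))%R.
have NV : (vmx n *m signature *m (vmx v)^T)%R = F.
  apply/matrixP => i j; rewrite -mink_mx !mxE.
  have [<-|/eqP ij] := i =P j; first by rewrite mulr1n.
  by rewrite mulr0n; apply: hn; rewrite eq_sym.
have VN : (vmx v *m signature *m (vmx n)^T)%R = F.
  by apply: trmx_inj; rewrite !trmx_mul trmxK /signature tr_diag_mx -/signature mulmxA NV tr_diag_mx.
have GE := gram_mink h1; rewrite -/x in GE.
have NE : (detn x *: vmx n)%R = (F *m A *m vmx v)%R.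
  have SU : (signature *m (vmx v)^T)%R \in unitmx.
    rewrite unitmx_mul unitmx_tr VU andbT unitmxE det_diag !big_ord_recl big_ord0 !mxE /=.
    by rewrite !mulr1 unitrN1.
  apply: (can_inj (mulmxK SU)).
  have -> : (F *m A *m vmx v *m (signature *m (vmx v)^T))%R =
    (F *m (A *m (vmx v *m signature *m (vmx v)^T)))%R by rewrite !mulmxA.
  by rewrite GE mul_gadj_gram mul_mx_scalar -scalemxAl mulmxA NV.
rewrite !RmultE; transitivity (((detn x *: vmx n) *m signature *m (vmx n)^T)%R c d).
  by rewrite -!scalemxAl mxE -mink_mx.
have -> : (detn x *: vmx n *m signature *m (vmx n)^T)%R =
  (F *m A *m (vmx v *m signature *m (vmx n)^T))%R by rewrite NE !mulmxA.
by rewrite VN mul_mx_diag mul_diag_mx !mxE.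
Qed.

Lemma normals_gram v n c d : hyperideal_tet v -> outward_normals v n ->
  let A := gadj (edge_mink v) in
  - mink (n c) (n d) = A c d / sqrt (A c c * A d d).
Proof.
move=> hv hn A; have hx := hyper_seq_mink hv; have [_ D0] := hx.
have NN i j := @normals_mink v n i j hv (fun h => proj2 (proj2 (hn h))).
have f0 h : mink (n h) (v h) < 0 by have [_ []] := hn h.
have n1 h : mink (n h) (n h) = 1 by have [] := hn h.
have cc := NN c c; have dd := NN d d; have {NN}cd := NN c d.
rewrite !n1 !Rmult_1_r -/A in cc dd cd; rewrite -/(detn _) in D0.
move: (f0 c) (f0 d) cc dd cd; set D := detn _ in D0 *.
move: (mink (n c) (v c)) (mink (n d) (v d)) => f g f_lt0 g_lt0 cc dd cd.
have fg : 0 < f * g by nra.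
(* Unit length of the normals gives D = f^2 A_cc = g^2 A_dd; both being outward makes f g positive
   and selects the root -D / (f g). *)
have -> : A c c * A d d = (- D / (f * g)) * (- D / (f * g)).
  by apply: (Rmult_eq_reg_r (f * g * (f * g))); [rewrite {1}cc in D0 *; field_simplify; nra|nra].
rewrite sqrt_square; last by apply/Rlt_le/Rdiv_lt_0_compat; lra.
apply: (Rmult_eq_reg_l D); last lra.
by rewrite -Ropp_mult_distr_r cd; field; lra.
Qed.

Lemma normals_exist v : hyperideal_tet v -> exists n, outward_normals v n.
Proof.
move=> hv; have hx := hyper_seq_mink hv; have [h1 _] := hv; have [_ D0] := hx.
set x := edge_mink v in hx D0; set A := gadj x; rewrite -/(detn x) in D0.
have Ac c : A c c < 0 by exact: gadj_diag_neg.
have GE := gram_mink h1; rewrite -/x in GE.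
have Dc c : 0 < detn x * A c c by have := Ac c; nra.
(* The rows of the adjugate give the dual basis up to scale. This factor makes them unit vectors,
   and det G < 0 makes them point outward. *)
pose g c := / sqrt (detn x * A c c).
have g0 c : 0 < g c by apply/Rinv_0_lt_compat/sqrt_lt_R0.
have g2 c : g c * g c * (detn x * A c c) = 1.
  have s := sqrt_lt_R0 _ (Dc c).
  by rewrite /g -{3}(sqrt_def _ (Rlt_le _ _ (Dc c))); field; lra.
pose N : 'M[R]_4 := (diag_mx (\row_c g c) *m A *m vmx v)%R.
pose n c k := N c k; have nE : vmx n = N by apply/matrixP => i j; rewrite mxE.
have nv h c : mink (n h) (v c) = (g h * (detn x *+ (h == c)))%R.
  rewrite mink_mx nE /N.
  have -> : (diag_mx (\row_c0 g c0) *m A *m vmx v *m signature *m (vmx v)^T)%R =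
     (diag_mx (\row_c0 g c0) *m (A *m (vmx v *m signature *m (vmx v)^T)))%R by rewrite !mulmxA.
  by rewrite GE mul_gadj_gram mul_diag_mx !mxE.
have nv0 h c : c != h -> mink (n h) (v c) = 0.
  by move=> ch; rewrite nv eq_sym (negbTE ch) mulr0n mulr0.
have nvh h : mink (n h) (v h) = g h * detn x by rewrite nv eqxx mulr1n.
exists n => h; split; last first.
  by split=> [|c]; [rewrite nvh; have := g0 h; nra|exact: nv0].
have := @normals_mink v n h h hv nv0; rewrite !nvh -/x -/A => e.
apply: (Rmult_eq_reg_l (detn x)); last lra.
by rewrite e -[in RHS](g2 h); ring.
Qed.

Lemma edge_mink_eq v v' L : hyperideal_tet v -> hyperideal_tet v' ->
  has_lengths v L -> has_lengths v' L ->
  forall k, (k < 6)%N -> edge_mink v' k = edge_mink v k.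
Proof.
move=> [_ [_ hv]] [_ [_ hv']] lv lv' k k6.
have ne : corner (edge_head k) != corner (edge_tail k).
  apply/eqP => /(congr1 val).
  by case: k k6 => [|[|[|[|[|[|k]]]]]] //= _; rewrite !inordK.
rewrite /edge_mink; apply: acosh_inj; rewrite ?lv ?lv' //.
  by have := hv' _ _ ne; lra.
by have := hv _ _ ne; lra.
Qed.

(** The angle is a chosen value, so two facts are needed: normals exist, and any realization with
    the same lengths has the same Gram matrix, hence the same angle. *)
Lemma dihedral_gadj v L a b c d : hyperideal_tet v -> has_lengths v L -> a != b ->
  [&& c != a, c != b, d != a, d != b & c != d] ->
  let A := gadj (edge_mink v) in
  dihedral L a b = acos (A c d / sqrt (A c c * A d d)).
Proof.
move=> hv lv ab cd A.
have ex : exists beta, is_dihedral L a b beta.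
  have [n hn] := normals_exist hv.
  exists (acos (A c d / sqrt (A c c * A d d))), v, n; split=> //; split=> //; split=> //.
  move=> c' d' cd'; rewrite (normals_gram _ _ hv hn) -/A.
  suff [[-> ->]|[-> ->]] : (c' = c /\ d' = d) \/ (c' = d /\ d' = c); [by []| |].
    by rewrite /A -{1}gadj_sym mxE Rmult_comm.
  have N (i j : 'I_4) : i != j -> (i : nat) <> j.
    by move=> ij /val_inj e; rewrite e eqxx in ij.
  have cover e : e != a -> e != b -> e = c \/ e = d.
    move: ab cd => /N ab /and5P[/N ca /N cb /N da /N db /N cd] /N ea /N eb.
    suff [e_c|e_d] : (e = c :> nat) \/ (e = d :> nat) by [left; exact: val_inj|right; exact: val_inj].
    have := ltn_ord a; have := ltn_ord b; have := ltn_ord c; have := ltn_ord d.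
    have := ltn_ord e; clear -ab ca cb da db cd ea eb; lia.
  case/and5P: cd' => c'a c'b d'a d'b c'd'.
  have [ec|ec] := cover c' c'a c'b; have [ed|ed] := cover d' d'a d'b; subst c' d'; try by auto.
    by rewrite eqxx in c'd'.
  by rewrite eqxx in c'd'.
have [v' [n [hv' [lv' [hn h]]]]] := ClassicalEpsilon.epsilon_spec (inhabits 0) _ ex.
rewrite -/(dihedral L a b) in h; rewrite (h c d cd) (normals_gram _ _ hv' hn).
suff -> : gadj (edge_mink v') = A by [].
by rewrite /gadj !(edge_mink_eq hv hv' lv lv').
Qed.

(** * The triangulated space *)

Import Num.Theory.

Lemma packed_lt k u u' v v' : 0 <= k -> 0 < u -> u < u' -> 0 < v -> v <= v' ->
  packed (sinh u) (cosh u) (sinh v) (cosh v) k < packed (sinh u') (cosh u') (sinh v') (cosh v') k.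
Proof.
move=> k0 u0 uu v0 vv; rewrite /packed.
have su := sinh_pos u u0; have suu := sinh_lt _ _ uu; have sv := sinh_pos v v0.
have cu := cosh_lt (Rlt_le _ _ u0) uu; have pu := cosh_pos u; have pv := cosh_pos v.
have svv : sinh v <= sinh v' by case: vv => [/sinh_lt|->]; lra.
have cvv : cosh v <= cosh v' by case: vv => [/(cosh_lt (Rlt_le _ _ v0))|->]; lra.
have : k * cosh u * cosh v <= k * cosh u' * cosh v'.
  have ? : 0 <= k * cosh u by apply: Rmult_le_pos; lra.
  by apply: Rmult_le_compat; try lra; apply: Rmult_le_compat; lra.
have : sinh u * sinh v < sinh u' * sinh v' by nra.
by lra.
Qed.

(* If one radius grows, equality along two edges forces the two others to
   shrink, which contradicts equality along the third edge. *)
Lemma triangle_le p q s u v w u' v' w' :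
  0 <= p -> 0 <= q -> 0 <= s -> 0 < u -> 0 < v -> 0 < w -> 0 < u' -> 0 < v' -> 0 < w' ->
  let f k x y := packed (sinh x) (cosh x) (sinh y) (cosh y) k in
  f p u' v' = f p u v -> f q u' w' = f q u w -> f s v' w' = f s v w -> u' <= u.
Proof.
move=> p0 q0 s0 u0 v0 w0 u0' v0' w0' f ep eq es; apply: Rnot_lt_le => uu.
have vv : v' < v.
  by apply: Rnot_le_lt => vv; have := packed_lt p0 u0 uu v0 vv; rewrite /f in ep; lra.
have ww : w' < w.
  by apply: Rnot_le_lt => ww; have := packed_lt q0 u0 uu w0 ww; rewrite /f in eq; lra.
by have := packed_lt s0 v0' vv w0' (Rlt_le _ _ ww); rewrite /f in es; lra.
Qed.

Lemma pairs_sum (F : 'I_4 -> 'I_4 -> R) :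
  (\sum_(a < 4) \sum_(b < 4 | (a < b)%N) F a b)%R =
  F (corner 0) (corner 1) + F (corner 0) (corner 2) + F (corner 0) (corner 3) +
  F (corner 1) (corner 2) + F (corner 1) (corner 3) + F (corner 2) (corner 3).
Proof.
have c0 : corner 0 = ord0 by apply: val_inj; rewrite /= inordK.
have c1 : corner 1 = lift ord0 ord0 by apply: val_inj; rewrite /= inordK.
have c2 : corner 2 = lift ord0 (lift ord0 ord0) by apply: val_inj; rewrite /= inordK.
have c3 : corner 3 = lift ord0 (lift ord0 (lift ord0 ord0)) by apply: val_inj; rewrite /= inordK.
rewrite c0 c1 c2 c3 !big_ord_recl big_ord0.
rewrite !(big_mkcond (fun b : 'I_4 => _ < b)%N) !big_ord_recl !big_ord0 /=.
rewrite -!RplusE -!R0E; ring.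
Qed.

Section Tetrahedron.
Variables (N : nat) (T : ideal_triangulation N) (Phi : 'I_(nedge T) -> R).
Hypothesis HPhi : forall e, 0 <= Phi e <= acos (1 / 3).

Lemma third_cos e : third (cos (Phi e)).
Proof.
have [h0 h1] := HPhi e; have [a0 a1] := acos_bound (1 / 3).
split; last by have [] := COS_bound (Phi e).
rewrite -[X in X <= _](cos_acos (1 / 3)); last lra.
by apply: cos_decr_1; lra.
Qed.

Definition tet_cos (t : 'I_(ntet T)) (k : nat) : R :=
  cos (Phi (tedge t (corner (edge_head k)) (corner (edge_tail k)))).
Definition tet_rad (r : 'I_N -> R) (t : 'I_(ntet T)) (a : nat) : R := r (tvert t (corner a)).

Definition tet_pack r t := packn (tet_cos t) (tet_rad r t).

Lemma edge_corners k : (k < 6)%N -> corner (edge_head k) != corner (edge_tail k).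
Proof.
move=> k6; apply/eqP => /(congr1 val).
by case: k k6 => [|[|[|[|[|[|k]]]]]] //= _; rewrite !inordK.
Qed.

(** Injectivity of [acosh] on [1, oo) turns equality of lengths into equality of Gram entries;
    admissibility provides the bound 1 for the packing values. *)
Lemma admissible_mink r t : admissible Phi r -> exists v,
  [/\ hyperideal_tet v, has_lengths v (tet_len Phi r t) &
   forall k, (k < 6)%N -> edge_mink v k = tet_pack r t k].
Proof.
move=> [_ /(_ t) [x1 [v [hv lv]]]]; exists v; split=> // k k6.
have ne := edge_corners k6; have [_ [_ hneg]] := hv.
apply: acosh_inj; first by have := hneg _ _ ne; rewrite /edge_mink; lra.
  exact: x1.
exact: lv.
Qed.

Lemma tet_pack_gt1 r t k : admissible Phi r -> (k < 6)%N -> 1 < tet_pack r t k.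
Proof.
move=> /(admissible_mink t) [v [[_ [_ hneg]] _ e]] k6; rewrite -e // /edge_mink.
by have := hneg _ _ (edge_corners k6); lra.
Qed.

Definition tet_pairing r (t : 'I_(ntet T)) (d : 'I_4 -> 'I_4 -> R) : R :=
  (\sum_(a < 4) \sum_(b < 4 | (a < b)%N) dihedral (tet_len Phi r t) a b * d a b)%R.

Lemma tet_pairingE r t d : admissible Phi r ->
  tet_pairing r t d = pairingn (tet_pack r t)
    (fun k => d (corner (edge_head k)) (corner (edge_tail k))).
Proof.
move=> ar; have [v [hv lv e]] := admissible_mink t ar.
rewrite /tet_pairing pairs_sum /pairingn /angle_pairing.
have dih a b c f (lt : [&& (a < 4)%N, (b < 4)%N, (c < 4)%N & (f < 4)%N]) :
    uniq [:: a; b; c; f] -> dihedral (tet_len Phi r t) (corner a) (corner b) =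
    let A := gadj (edge_mink v) in
    acos (A (corner c) (corner f) / sqrt (A (corner c) (corner c) * A (corner f) (corner f))).
  move=> un; have N' i j : (i < 4)%N -> (j < 4)%N -> i != j -> corner i != corner j.
    by move=> i4 j4; apply: contra => /eqP/(congr1 val); rewrite /= !inordK // => /eqP.
  case/and4P: lt => a4 b4 c4 f4.
  move: un; rewrite /= !inE !negb_or !andbT => /and3P[/and3P[ab ac af] /andP[bc bf] cf].
  by apply: (dihedral_gadj hv lv); [exact: N'|apply/and5P; split; apply: N' => //; rewrite eq_sym].
rewrite (dih 0 1 2 3)%N // (dih 0 2 1 3)%N // (dih 0 3 1 2)%N // (dih 1 2 0 3)%N // (dih 1 3 0 2)%N //
  (dih 2 3 0 1)%N //.
rewrite /= /gadj !mxE /= !inordK //= !e // /angle.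
repeat apply: (f_equal2 Rplus); apply: (f_equal2 Rmult) => //;
  apply: (f_equal acos); apply: (f_equal2 Rdiv); try apply: (f_equal sqrt);
  by rewrite /gcof /gminor; ring.
Qed.

Lemma tet_local r0 t : admissible Phi r0 -> exists eps, 0 < eps /\
  forall r, admissible Phi r -> (forall i, Rabs (r i - r0 i) < eps) ->
    let d a b := tet_len Phi r t a b - tet_len Phi r0 t a b in
    tet_pairing r t d <= tet_pairing r0 t d ->
    forall k, (k < 6)%N -> d (corner (edge_head k)) (corner (edge_tail k)) = 0.
Proof.
move=> ar0; have [r0_gt0 _] := ar0.
pose B := tet_rad r0 t 0 + tet_rad r0 t 1 + tet_rad r0 t 2 + tet_rad r0 t 3.
have rB a : 0 < tet_rad r0 t a <= B.
  split; first exact: r0_gt0.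
  have p k : 0 < tet_rad r0 t k := r0_gt0 _.
  have := p 0%N; have := p 1%N; have := p 2%N; have := p 3%N.
  (* [corner] maps every natural number to one of the four corners, so the bound B holds for all
     indices. *)
  have -> : tet_rad r0 t a = tet_rad r0 t (corner a) by rewrite /tet_rad /corner inord_val.
  by rewrite /B; case: (corner a) => [[|[|[|[|k]]]] lk] //=; lra.
have [e [e0 he]] := tet_rigid rB (fun k => third_cos _) (fun k => tet_pack_gt1 t ar0).
exists e; split=> // r ar hr d; rewrite !tet_pairingE // => hle k k6.
by apply: (he (tet_rad r t) _ hle k k6) => a _; exact: hr.
Qed.

Lemma edge_cover (P : 'I_4 -> 'I_4 -> Prop) :
  (forall a b, P a b -> P b a) ->
  (forall k, (k < 6)%N -> P (corner (edge_head k)) (corner (edge_tail k))) ->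
  forall a b, a != b -> P a b.
Proof.
move=> Psym Pedge.
have lt (a b : 'I_4) : (a < b)%N -> P a b.
  have cE (c : 'I_4) : c = corner c by rewrite /corner inord_val.
  rewrite (cE a) (cE b) => ab.
  suff [k k6 [-> ->]] : exists2 k, (k < 6)%N & corner a = corner (edge_head k) /\ corner b = corner (edge_tail k).
    exact: Pedge.
  move: ab; rewrite !inordK ?ltn_ord //; case: a => [[|[|[|[|a]]]] la] //; case: b => [[|[|[|[|b]]]] lb] //= _;
  by [exists 0%N|exists 1%N|exists 2%N|exists 3%N|exists 4%N|exists 5%N].
move=> a b ab; case: (ltngtP a b) => [/lt|/lt/Psym|/val_inj e] //.
by rewrite e eqxx in ab.
Qed.

Lemma tet_len_sym r t a b : tet_len Phi r t a b = tet_len Phi r t b a.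
Proof.
rewrite /tet_len /cosh_len tedge_sym (Rmult_comm (sinh _)).
by rewrite Rmult_assoc (Rmult_comm (cosh _) (cosh _)) -Rmult_assoc.
Qed.

(** Any face through the corner suffices: [triangle_le] is applied to it in both directions. *)
Lemma tet_radii_eq r r0 t : admissible Phi r -> admissible Phi r0 ->
  (forall a b, a != b -> tet_len Phi r t a b = tet_len Phi r0 t a b) ->
  forall a, r (tvert t a) = r0 (tvert t a).
Proof.
move=> ar ar0 len a.
have [r_gt0 /(_ t) [x1 _]] := ar; have [r0_gt0 /(_ t) [x01 _]] := ar0.
have clen b c : b != c -> cosh_len Phi r t b c = cosh_len Phi r0 t b c.
  by move=> bc; apply: acosh_inj; [exact: x1|exact: x01|exact: len].
have [b [c [ab ac bc]]] : exists b c : 'I_4, [/\ a != b, a != c & b != c].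
  by case: a => [[|[|[|[|a]]]] la] //;
    [exists (corner 1), (corner 2)|exists (corner 0), (corner 2)|
     exists (corner 0), (corner 1)|exists (corner 0), (corner 1)];
    split; apply/eqP => /(congr1 val); rewrite /= !inordK.
have c0 e : 0 <= cos (Phi e) by have [] := third_cos e; lra.
have eab := clen a b ab; have eac := clen a c ac; have ebc := clen b c bc.
by apply: Rle_antisym;
  [apply: (triangle_le (c0 (tedge t a b)) (c0 (tedge t a c)) (c0 (tedge t b c))
     (r0_gt0 (tvert t a)) (r0_gt0 (tvert t b)) (r0_gt0 (tvert t c))
     (r_gt0 (tvert t a)) (r_gt0 (tvert t b)) (r_gt0 (tvert t c)))
  |apply: (triangle_le (c0 (tedge t a b)) (c0 (tedge t a c)) (c0 (tedge t b c))
     (r_gt0 (tvert t a)) (r_gt0 (tvert t b)) (r_gt0 (tvert t c))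
     (r0_gt0 (tvert t a)) (r0_gt0 (tvert t b)) (r0_gt0 (tvert t c)))].
Qed.

(** * Gluing: from tetrahedra to edges *)

Lemma slot_connect_vert t a b t' a' b' :
  connect (slot_rel (@gtet N T) (@gmap N T)) (t, a, b) (t', a', b') ->
  tvert t a = tvert t' a' /\ tvert t b = tvert t' b'.
Proof.
move=> /connectP [p]; elim: p t a b => [|[[t1 a1] b1] p IH] t a b /=; first by move=> _ [-> -> ->].
case/andP=> /existsP [f /and3P [fa fb /eqP [-> -> ->]]] hp hl.
have [<- <-] := IH _ _ _ hp hl.
by split; rewrite glue_vert // eq_sym.
Qed.

(** The slots of an edge are linked by gluings, which preserve the end vertices, possibly after
    exchanging the two ends. *)
Lemma tet_len_edge r t a b t' a' b' : a != b -> a' != b' ->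
  tedge t a b = tedge t' a' b' -> tet_len Phi r t a b = tet_len Phi r t' a' b'.
Proof.
move=> ab ab' e; case/orP: (edge_classes ab ab' e) => /slot_connect_vert [va vb].
  by rewrite /tet_len /cosh_len e va vb.
rewrite [RHS]tet_len_sym /tet_len /cosh_len e va vb.
by rewrite (tedge_sym t' b').
Qed.

Definition edge_angles r (e : 'I_(nedge T)) : R :=
  (\sum_t \sum_(a < 4) \sum_(b < 4 | (a < b)%N && (tedge t a b == e))
     dihedral (tet_len Phi r t) a b)%R.

Lemma ricciE r e : ricci Phi r e = 2 * PI - edge_angles r e.
Proof.
rewrite /ricci /edge_angles; congr (_ - _).
rewrite foldrE big_map big_filter big_filter_cond big_enum_cond /=.
rewrite pair_big /= pair_big_dep /=.
apply: eq_big => [[[t a] b]|[[t a] b] _] //=.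
Qed.

(** Double counting of the slots, by tetrahedron and by edge; the second count brings in the edge
    curvatures. *)
Lemma sum_tet_pairing r (d : 'I_(ntet T) -> 'I_4 -> 'I_4 -> R) (D : 'I_(nedge T) -> R) :
  (forall t a b, a != b -> d t a b = D (tedge t a b)) ->
  (\sum_t tet_pairing r t (d t) = \sum_e edge_angles r e * D e)%R.
Proof.
move=> dD.
transitivity (\sum_t \sum_(a < 4) \sum_e \sum_(b < 4 | (a < b)%N && (tedge t a b == e))
   dihedral (tet_len Phi r t) a b * D e)%R.
  apply: eq_bigr => t _; apply: eq_bigr => a _.
  rewrite (partition_big (tedge t a) xpredT) //=; apply: eq_bigr => e _.
  apply: eq_bigr => b /andP [ab /eqP <-]; rewrite dD //.
  by apply: contraTneq ab => ->; rewrite ltnn.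
under eq_bigr do rewrite exchange_big /=.
rewrite exchange_big /=; apply: eq_bigr => e _.
rewrite /edge_angles big_distrl /=; apply: eq_bigr => t _.
rewrite big_distrl /=; apply: eq_bigr => a _.
by rewrite big_distrl.
Qed.

End Tetrahedron.

Theorem theorem1p3 (N : nat) (T : ideal_triangulation N)
  (Phi : 'I_(nedge T) -> R)
  (HPhi : forall e, 0 <= Phi e <= acos (1 / 3))
  (rbar : 'I_N -> R) (Hrbar : admissible Phi rbar) :
  exists eps : R, 0 < eps /\
    forall r : 'I_N -> R, admissible Phi r ->
      (forall i, Rabs (r i - rbar i) < eps) ->
      (forall e, ricci Phi r e = ricci Phi rbar e) ->
      forall i, r i = rbar i.
Proof.
pose d r (t : 'I_(ntet T)) a b := tet_len Phi r t a b - tet_len Phi rbar t a b.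
have [eps [eps0 heps]] : exists eps, 0 < eps /\ forall k, (k < ntet T)%N ->
    forall t : 'I_(ntet T), t = k :> nat -> forall r, admissible Phi r ->
      (forall i, Rabs (r i - rbar i) < eps) ->
      tet_pairing Phi r t (d r t) <= tet_pairing Phi rbar t (d r t) ->
      forall j, (j < 6)%N -> d r t (corner (edge_head j)) (corner (edge_tail j)) = 0.
  apply: near_all => [k e e' _ ee h t tk r ar hr|k kn].
    by apply: h => // i; apply: Rlt_le_trans (hr i) ee.
  have [e [e0 he]] := tet_local HPhi (Ordinal kn) Hrbar; exists e; split=> // t tk r ar hr.
  by rewrite (_ : t = Ordinal kn); [exact: he|exact: val_inj].
exists eps; split=> // r ar hr K.
have d0 t a b : tet_pairing Phi r t (d r t) <= tet_pairing Phi rbar t (d r t) ->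
    a != b -> d r t a b = 0.
  move=> hle; move: a b; apply: edge_cover => [a b|k k6].
    by rewrite /d !(tet_len_sym _ _ _ a b).
  exact: (heps t (ltn_ord t) t erefl r ar hr hle).
have pair0 t s : (forall a b, a != b -> d r t a b = 0) -> tet_pairing Phi s t (d r t) = 0.
  move=> z; rewrite /tet_pairing big1 // => a _; rewrite big1 // => b ab.
  by rewrite z; [rewrite mulr0|apply: contraTneq ab => ->; rewrite ltnn].
(* A strict decrease would force all length changes of t to vanish, and then both pairings are 0. *)
have mono t : tet_pairing Phi rbar t (d r t) <= tet_pairing Phi r t (d r t).
  apply: Rnot_lt_le => lt; have z a b := d0 t a b (Rlt_le _ _ lt).
  by rewrite !pair0 // in lt; lra.
have len_edge s t a b t' a' b' := @tet_len_edge N T Phi s t a b t' a' b'.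
(* The length change descends to the edges of the triangulation, since it agrees on all slots of an
   edge. *)
have [D dD] : exists D : 'I_(nedge T) -> R, forall t a b, a != b -> d r t a b = D (tedge t a b).
  exists (fun e => epsilon (inhabits 0) (fun x =>
    exists t a b, [/\ a != b, tedge t a b = e & d r t a b = x])) => t a b ab.
  have [t' [a' [b' [ab' e' <-]]]] := epsilon_spec (inhabits 0)
    (fun x => exists t' a' b', [/\ a' != b', tedge t' a' b' = tedge t a b & d r t' a' b' = x])
    (ex_intro _ (d r t a b) (ex_intro _ t (ex_intro _ a (ex_intro _ b (And3 ab erefl erefl))))).
  by rewrite /d !(len_edge _ t a b t' a' b').
have total : (\sum_t (tet_pairing Phi r t (d r t) - tet_pairing Phi rbar t (d r t)) = 0)%R.
  rewrite sumrB !(sum_tet_pairing _ _ dD) -sumrB big1 // => e _.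
  have := K e; rewrite !ricciE => Ke.
  by rewrite (_ : edge_angles Phi r e = edge_angles Phi rbar e) ?subrr //; lra.
(* The nonnegative differences sum to zero, so each is zero and local rigidity applies in every
   tetrahedron. *)
have z t a b : a != b -> d r t a b = 0.
  apply: d0; right; apply: Rminus_diag_uniq.
  have nn s : true -> (0 <= tet_pairing Phi r s (d r s) - tet_pairing Phi rbar s (d r s))%R.
    by move=> _; apply/RleP; rewrite -RminusE -R0E; have := mono s; lra.
  exact: (psumr_eq0P nn total isT).
move=> i; have [t [c <-]] := @tvert_surj N T i.
by apply: (tet_radii_eq HPhi ar Hrbar) => a b ab; apply: Rminus_diag_uniq; exact: z.
Qed.
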